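(* Consider the linear model $y=X\beta^*+\varepsilon$ with random sub-Gaussian design, where $\beta^*\in\mathcal{S}(k,s_1,s_2)$. Assume that $X$ is a row-wise $(\sigma_x,\Sigma_x)$-sub-Gaussian random matrix whose covariance $\Sigma_x$ has all eigenvalues in $[c,c']$ for constants $0<c\le c'$ not depending on the dimensions. Let $\lambda\asymp\sigma_\varepsilon\sqrt{\frac{\log n}{N}}$ and $\lambda_g=\lambda\sqrt{\nu/(2d)^{k+1}}$, where $0\le\nu<1$ is a constant and $d$ is the maximum degree of the underlying graph. Assume $s_2/s_1\ge\nu$. Then the $k$-th order Graph-Piecewise-Polynomial-Lasso $\hat\beta$ with tuning parameters $\lambda,\lambda_g$ satisfies $$\|\hat\beta-\beta^*\|_2\le\mathcal{O}_{\mathbb{P}}\left(\sigma_\varepsilon\sqrt{\frac{s_2\log n}{N}}\right),\qquad \|\hat\beta-\beta^*\|_1\le\mathcal{O}_{\mathbb{P}}\left(\sigma_\varepsilon s_2\sqrt{\frac{\log n}{N}}\right),$$ and $$\frac1N\|X(\hat\beta-\beta^* )\|_2^2\le\mathcal{O}_{\mathbb{P}}\left(\sigma_\varepsilon^2\frac{s_2\log n}{N}\right).$$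
   Context: Graph: $\mathcal{G}=(\mathcal{V},\mathcal{E})$ is a known undirected graph with $n$ nodes labelled $1,\dots,n$, $p$ edges, and maximum degree $d$. Its oriented incidence matrix $F\in\{-1,0,1\}^{p\times n}$ has, for the row corresponding to the edge $(i,j)$ with $i<j$, entry $-1$ in position $i$, $+1$ in position $j$, and $0$ elsewhere. The Laplacian is $L=F^TF$. Graph difference operators: $\Delta^{(1)}=F$, and for $k\ge1$, $\Delta^{(k+1)}=F^T\Delta^{(k)}=L^{(k+1)/2}$ if $k$ is odd, $\Delta^{(k+1)}=F\Delta^{(k)}=FL^{k/2}$ if $k$ is even. $k\ge0$ is a fixed integer. Parameter space: $\mathcal{S}(k,s_1,s_2)=\{\beta\in\mathbb{R}^n:\|\Delta^{(k+1)}\beta\|_0\le s_1,\ \|\beta\|_0\le s_2\}$, where $s_1,s_2>0$ and $\|\cdot\|_0$ counts nonzero entries. Model: $X\in\mathbb{R}^{N\times n}$, $y\in\mathbb{R}^N$; the components of $\varepsilon\in\mathbb{R}^N$ are i.i.d. $\sigma_\varepsilon$-sub-Gaussian, and $\varepsilon$ is independent of $X$. A random variable $Z$ is $\sigma$-sub-Gaussian if $\mathbb{E}Z=0$ and $\mathbb{E}e^{tZ}\le e^{\sigma^2t^2/2}$ for all $t\in\mathbb{R}$; a random vector $Z$ is $\sigma$-sub-Gaussian if $\mathbb{E}Z=0$ and $u^TZ$ is $\sigma$-sub-Gaussian for every unit vector $u$. $X$ is a row-wise $(\sigma_x,\Sigma_x)$-sub-Gaussian random matrix if its rows are i.i.d.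 from a $\sigma_x$-sub-Gaussian distribution with covariance matrix $\Sigma_x$. Estimator: for $\lambda>0,\lambda_g\ge0$, the $k$-th order Graph-Piecewise-Polynomial-Lasso is $$\hat\beta\in\arg\min_{\beta\in\mathbb{R}^n}\ \frac1{2N}\|y-X\beta\|_2^2+\lambda_g\|\Delta^{(k+1)}\beta\|_1+\lambda\|\beta\|_1 .$$ Asymptotics: $N,n,p,s_1,s_2$ are allowed to increase to $\infty$ (the graph changing accordingly); $k,\nu,\sigma_\varepsilon,\sigma_x$ and the eigenvalue bounds are fixed. $f\asymp g$ means equality of order up to positive constants; the choice $\lambda\asymp g$ means that $\lambda$ is taken to be $g$ times a suitable positive constant. ''$Z\le\mathcal{O}_{\mathbb{P}}(a)$'' means that $Z/a$ is stochastically bounded.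
   Formalization: The formal theorem adds that N tends to infinity and N is at least a constant (depending only on the fixed parameters) times s_2 log n eventually; without this, beta* may be unidentifiable and, being unbounded, makes the error exceed any stated rate. *)

(* Defs.v *)
From HB Require Import structures.
From mathcomp Require Export all_boot all_order all_algebra.
From mathcomp Require Export all_classical all_reals all_analysis.

Set Implicit Arguments.
Unset Strict Implicit.
Unset Printing Implicit Defensive.

Import Order.TTheory GRing.Theory Num.Theory.
Import numFieldNormedType.Exports.

#[global] Open Scope classical_set_scope.
#[global] Open Scope ring_scope.

Definition l0norm (R : realType) n (v : 'cV[R]_n) : nat :=
  #|[set i : 'I_n | v i 0 != 0]%SET|.

(* The library norm on matrices is the sup norm. *)
Definition l1norm (R : realType) n (v : 'cV[R]_n) : R :=
  \sum_(i < n) `|v i 0|.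

Definition l2norm (R : realType) n (v : 'cV[R]_n) : R :=
  Num.sqrt (\sum_(i < n) v i 0 ^+ 2).

Record sgraph (n : nat) := SGraph {
  adj :> rel 'I_n;
  adj_sym : symmetric adj;
  adj_irr : irreflexive adj }.

(* Each undirected edge is represented once, as (i, j) with i < j. *)
Definition edges n (G : sgraph n) : {set 'I_n * 'I_n} :=
  [set e : 'I_n * 'I_n | (e.1 < e.2)%N && G e.1 e.2]%SET.

Definition max_degree n (G : sgraph n) : nat :=
  \max_(i < n) #|[set j : 'I_n | G i j]%SET|.

Definition incidence (R : realType) n (G : sgraph n) :
    'M[R]_(#|edges G|, n) :=
  \matrix_(r, v)
    (let e := enum_val r in
     if v == e.1 then -1 else if v == e.2 then 1 else 0).

Definition diffop_step (R : realType) n (G : sgraph n) (b : bool) :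
    'M[R]_(if b then n else #|edges G|, n) ->
    'M[R]_(if ~~ b then n else #|edges G|, n) :=
  if b as b' return
      'M[R]_(if b' then n else #|edges G|, n) ->
      'M[R]_(if ~~ b' then n else #|edges G|, n)
  then fun D => incidence R G *m D
  else fun D => (incidence R G)^T *m D.

(* diffop R G k is the operator Delta^(k+1), of order k+1: it has p = #|E| rows
   when k is even and n rows when k is odd. *)
Fixpoint diffop (R : realType) n (G : sgraph n) (k : nat) :
    'M[R]_(if odd k then n else #|edges G|, n) :=
  match k as k' return 'M[R]_(if odd k' then n else #|edges G|, n) with
  | 0 => incidence R G
  | k'.+1 => diffop_step (diffop R G k')
  end.

Definition param_space (R : realType) n (G : sgraph n) (k s1 s2 : nat) :
    set 'cV[R]_n :=
  [set beta | (l0norm (diffop R G k *m beta) <= s1)%N /\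
              (l0norm beta <= s2)%N].

Definition gpp_objective (R : realType) (N n : nat) (G : sgraph n) (k : nat)
    (lambda lambda_g : R) (X : 'M[R]_(N, n)) (y : 'cV[R]_N) (beta : 'cV[R]_n)
    : R :=
  (2 * N%:R)^-1 * l2norm (y - X *m beta) ^+ 2
  + lambda_g * l1norm (diffop R G k *m beta)
  + lambda * l1norm beta.

Definition gpp_lasso (R : realType) (N n : nat) (G : sgraph n) (k : nat)
    (lambda lambda_g : R) (X : 'M[R]_(N, n)) (y : 'cV[R]_N) : set 'cV[R]_n :=
  [set bhat | forall beta, gpp_objective G k lambda lambda_g X y bhat
                        <= gpp_objective G k lambda lambda_g X y beta].

(* The library equips n.-tuple T with the product sigma-algebra, so random
   vectors and matrices are regarded as random tuples to speak of their
   measurability, law and independence. *)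
Definition vtuple (R : realType) n (v : 'cV[R]_n)
    : n.-tuple (measurableTypeR R) :=
  [tuple v i 0 | i < n].

Definition row_of (R : realType) (T : Type) (N n : nat)
    (X : T -> 'M[R]_(N, n)) (r : 'I_N) : T -> 'cV[R]_n :=
  fun w => (row r (X w))^T.

Definition mxtuple (R : realType) (N n : nat) (A : 'M[R]_(N, n))
    : N.-tuple (n.-tuple (measurableTypeR R)) :=
  [tuple vtuple (row r A)^T | r < N].

Definition indep2 d1 d2 d3 (T : measurableType d1) (R : realType)
    (P : probability T R) (U : measurableType d2) (V : measurableType d3)
    (Y : T -> U) (Z : T -> V) : Prop :=
  forall (A : set U) (B : set V), measurable A -> measurable B ->
    P (Y @^-1` A `&` Z @^-1` B) = (P (Y @^-1` A) * P (Z @^-1` B))%E.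

(* The product rule over subfamilies is the case A i = setT off the subfamily. *)
Definition mutual_indep d1 d2 (T : measurableType d1) (R : realType)
    (P : probability T R) (U : measurableType d2) N (Y : 'I_N -> T -> U)
    : Prop :=
  forall A : 'I_N -> set U, (forall i, measurable (A i)) ->
    P (\bigcap_(i in [set: 'I_N]) (Y i @^-1` A i))
    = (\prod_(i < N) P (Y i @^-1` A i))%E.

Definition iid d1 d2 (T : measurableType d1) (R : realType)
    (P : probability T R) (U : measurableType d2) N (Y : 'I_N -> T -> U)
    : Prop :=
  [/\ forall i, measurable_fun [set: T] (Y i),
      mutual_indep P Y &
      forall i j (A : set U), measurable A ->
        P (Y i @^-1` A) = P (Y j @^-1` A)].

(* mmt_gen_fun P Z t is E[exp (t Z)], in \bar R. *)
Definition subgaussian d (T : measurableType d) (R : realType)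
    (P : probability T R) (sigma : R) (Z : T -> R) : Prop :=
  'E_P[Z]%E = 0%E /\
  forall t : R, (mmt_gen_fun P Z t <= (expR (sigma ^+ 2 * t ^+ 2 / 2))%:E)%E.

Definition subgaussian_vec d (T : measurableType d) (R : realType)
    (P : probability T R) (sigma : R) n (Z : T -> 'cV[R]_n) : Prop :=
  (forall i, 'E_P[(fun w => Z w i 0)%R]%E = 0%E) /\
  forall u : 'cV[R]_n, l2norm u = 1 ->
    subgaussian P sigma (fun w => (u^T *m Z w) 0 0).

Definition rowwise_subgaussian d (T : measurableType d) (R : realType)
    (P : probability T R) (N n : nat) (sigma : R) (Sigma : 'M[R]_n)
    (X : T -> 'M[R]_(N, n)) : Prop :=
  [/\ iid P (fun (r : 'I_N) w => vtuple (row_of X r w)),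
      forall r, subgaussian_vec P sigma (row_of X r) &
      forall r a b,
        covariance P (fun w => X w r a) (fun w => X w r b)
        = (Sigma a b)%:E].

Definition eigenvalues_in (R : realType) n (A : 'M[R]_n) (a b : R) : Prop :=
  forall x, eigenvalue A x -> a <= x <= b.

(* Z m lives on its own probability space, as the dimensions vary with m. *)
Definition stochastically_bounded (R : realType) (disp : nat -> measure_display)
    (Om : forall m, measurableType (disp m))
    (P : forall m, probability (Om m) R) (Z : forall m, Om m -> R) : Prop :=
  forall delta : R, 0 < delta ->
    exists M : R, \forall m \near \oo,
      (P m [set w | (M < `|Z m w|)%R] <= delta%:E)%E.

Definition le_OP (R : realType) (disp : nat -> measure_display)
    (Om : forall m, measurableType (disp m))
    (P : forall m, probability (Om m) R)
    (Z : forall m, Om m -> R) (a : nat -> R) : Prop :=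
  stochastically_bounded P (fun m w => Z m w / a m).

(* Main.v *)
From HB Require Import structures.
Require Import Defs.
From mathcomp Require Import finmap measurable_realfun.
From mathcomp Require Import ring lra.

Set Implicit Arguments.
Unset Strict Implicit.
Unset Printing Implicit Defensive.

Import Order.TTheory GRing.Theory Num.Theory.
Import numFieldNormedType.Exports.

(** Write h for the error of the estimator, S for the support of the true
    vector, r for sqrt s2, and let B l bound the entries of X^T eps / N, where l
    is the penalty level.  Comparing the objective at the estimator and at the
    truth gives
      |X h|^2 / (2 N) <= l (B |h|_1 + r |h|_2 + |h_S|_1 - |h_{S^c}|_1).
    The term r |h|_2 is all that is left of the graph penalty: its change is at
    most sqrt s1 |Delta h|_2 with |Delta h|_2^2 <= (2 d)^(k+1) |h|_2^2, and the
    choice of lambda_g together with nu s1 <= s2 cancels d, k and s1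
    (graph_penalty_le).  For B = 1/2 the nonnegativity of the left side forces
    |h|_1 <= 6 r |h|_2.  On that cone a restricted eigenvalue bound
    a |h|_2^2 <= |X h|^2 / N yields the three rates (gpp_rate).

    The restricted eigenvalue bound comes from Maurey's averaging argument.  If
    the quadratic form |X v|^2 / N - (c / 2) |v|^2 is nonnegative on all sums v of
    q + 1 signed basis vectors and the columns of X have squared norm at most D N,
    then the form is at least - D |x|_1^2 / q at every x (restricted_form_ge,
    restricted_eigenvalue).  There are only (2 n)^(q+1) such sums, so a union bound
    over them suffices; no net of a sphere enters.  For one fixed v the lower tail
    of |X v|^2 needs only the second and fourth moments of v . X_i, and the second
    moment is bounded below by the smallest eigenvalue of Sigma
    (sqnorm_lower_tail, min_eigenvalue_le).  The column norms are controlled by an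
    exponential moment of the square of a sub-Gaussian variable
    (subgaussian_exp_square), and then, conditionally on X, each entry of X^T eps
    is sub-Gaussian (noise_tail_sided).  With q of order s2 and N >= C0 s2 log n
    the first two failure probabilities are exponentially small in N; that of the
    noise bound is 2 / n for B = 1/2.

    Only N is assumed to tend to infinity, and for bounded n the probability 2 / n
    does not become small.  So, given delta, the dimensions are split at a
    threshold n0 of order 1 / delta.  For n >= n0 the argument is the one above.
    For n < n0 the constant B is taken large, which makes the noise event as likely
    as needed, and the cone inequality is replaced by the trivial
    |h|_1 <= sqrt n0 |h|_2, with a q that depends on n0 only.  The constant A of
    the penalty level is the same in both cases: B enters only the analysis and
    the resulting constant M. *)

(** * Norms and sums of squares *)

Section Norms.
Context {R : realType}.
Lemma cauchy_schwarz_sum (I : finType) (a b : I -> R) :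
  (\sum_i a i * b i) ^+ 2 <= (\sum_i a i ^+ 2) * (\sum_i b i ^+ 2).
Proof.
have H : 0 <= \sum_i \sum_j (a i * b j - a j * b i) ^+ 2.
  by apply: sumr_ge0 => i _; apply: sumr_ge0 => j _; exact: sqr_ge0.
have E : \sum_i \sum_j (a i * b j - a j * b i) ^+ 2 =
   2 * ((\sum_i a i ^+ 2) * (\sum_i b i ^+ 2)) - 2 * (\sum_i a i * b i) ^+ 2.
  transitivity (\sum_i \sum_j (a i ^+ 2 * b j ^+ 2) + \sum_i \sum_j (b i ^+ 2 * a j ^+ 2)
     - 2 * \sum_i \sum_j ((a i * b i) * (a j * b j))).
    rewrite mulr_sumr -sumrN -!big_split /=; apply: eq_bigr => i _.
    rewrite mulr_sumr -sumrN -!big_split /=; apply: eq_bigr => j _; ring.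
  have T (f g : I -> R) : \sum_i \sum_j f i * g j = (\sum_i f i) * (\sum_j g j).
    by rewrite mulr_suml; apply: eq_bigr => i _; rewrite mulr_sumr.
  rewrite !T; ring.
lra.
Qed.

Definition sqnorm n (v : 'cV[R]_n) : R := \sum_i v i 0 ^+ 2.

Lemma sqnorm_ge0 n (v : 'cV[R]_n) : 0 <= sqnorm v.
Proof. by apply: sumr_ge0 => i _; exact: sqr_ge0. Qed.

Lemma sqr_l2norm n (v : 'cV[R]_n) : l2norm v ^+ 2 = sqnorm v.
Proof. by rewrite /l2norm sqr_sqrtr // sqnorm_ge0. Qed.

Lemma l2norm_ge0 n (v : 'cV[R]_n) : 0 <= l2norm v.
Proof. exact: sqrtr_ge0. Qed.

Lemma sqnorm_eq0 n (v : 'cV[R]_n) : sqnorm v = 0 -> v = 0.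
Proof.
move=> /eqP; rewrite psumr_eq0; last by move=> i _; exact: sqr_ge0.
move=> /allP H; apply/matrixP => i j; rewrite ord1 mxE.
by have /= := H i (mem_index_enum _); rewrite sqrf_eq0 => /eqP.
Qed.

Lemma dotmxE n (u v : 'cV[R]_n) : (u^T *m v) 0 0 = \sum_i u i 0 * v i 0.
Proof. by rewrite mxE; apply: eq_bigr => i _; rewrite mxE. Qed.

Lemma sqnormE n (v : 'cV[R]_n) : sqnorm v = (v^T *m v) 0 0.
Proof. by rewrite dotmxE; apply: eq_bigr => i _. Qed.

Lemma sqnormZ n (a : R) (v : 'cV[R]_n) : sqnorm (a *: v) = a ^+ 2 * sqnorm v.
Proof. by rewrite mulr_sumr; apply: eq_bigr => i _; rewrite mxE exprMn. Qed.

Lemma cauchy_schwarz_dot n (u v : 'cV[R]_n) :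
  ((u^T *m v) 0 0) ^+ 2 <= sqnorm u * sqnorm v.
Proof. rewrite dotmxE; exact: cauchy_schwarz_sum. Qed.

Lemma sqnorm_mulmx_le m n (A : 'M[R]_(m, n)) (v : 'cV[R]_n) :
  sqnorm (A *m v) <= (\sum_i \sum_j A i j ^+ 2) * sqnorm v.
Proof.
rewrite mulr_suml; apply: ler_sum => i _; rewrite mxE.
exact: cauchy_schwarz_sum.
Qed.

Lemma l1norm_ge0 n (v : 'cV[R]_n) : 0 <= l1norm v.
Proof. exact: sumr_ge0. Qed.

Lemma l1norm_eq0 n (v : 'cV[R]_n) : l1norm v = 0 -> v = 0.
Proof.
move=> /eqP; rewrite psumr_eq0 //.
move=> /allP H; apply/matrixP => i j; rewrite ord1 mxE.
by have /= := H i (mem_index_enum _); rewrite normr_eq0 => /eqP.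
Qed.

Lemma sum_norm_set_le n (A : {set 'I_n}) (s : nat) (v : 'cV[R]_n) :
  (#|A| <= s)%N ->
  \sum_(i in A) `|v i 0| <= Num.sqrt s%:R * l2norm v.
Proof.
move=> As.
rewrite -(ler_pXn2r (ltn0Sn 1)) ?nnegrE ?mulr_ge0 ?sqrtr_ge0 ?sumr_ge0 //.
rewrite exprMn sqr_sqrtr ?ler0n // sqr_l2norm.
have -> : \sum_(i in A) `|v i 0| = \sum_i (i \in A)%:R * `|v i 0|.
  by rewrite big_mkcond; apply: eq_bigr => i _; case: (i \in A); rewrite ?mul1r ?mul0r.
apply: le_trans (cauchy_schwarz_sum _ _) _.
apply: ler_pM; rewrite ?sumr_ge0 //; [by move=> ? _; exact: sqr_ge0.. | |].
  apply: (@le_trans _ _ (#|A|%:R)); last by rewrite ler_nat.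
  rewrite -sum1_card natr_sum [leRHS]big_mkcond /=; apply: ler_sum => i _.
  by case: (i \in A); rewrite ?expr1n ?expr0n.
by apply: ler_sum => i _; rewrite real_normK ?num_real.
Qed.

Lemma l1norm_le n (v : 'cV[R]_n) : l1norm v <= Num.sqrt n%:R * l2norm v.
Proof.
have := @sum_norm_set_le n [set: 'I_n] n v; rewrite cardsT card_ord => /(_ (leqnn _)).
by congr (_ <= _); apply: eq_bigl => i; rewrite inE.
Qed.

(** Off the support of b the l1 norm of b + h is that of h, and on it the
    triangle inequality loses at most the l1 norm of h. *)
Lemma l1norm_sparse n (b h : 'cV[R]_n) :
  l1norm b - l1norm (b + h) <=
    \sum_(i in [set i | b i 0 != 0]%SET) `|h i 0|
    - \sum_(i in ~: [set i | b i 0 != 0]%SET) `|h i 0|.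
Proof.
set S := [set i | _]%SET.
have dec (f : 'I_n -> R) : \sum_i f i = \sum_(i in S) f i + \sum_(i in ~: S) f i.
  by rewrite (bigID (mem S)) /=; congr (_ + _); apply: eq_bigl => i; rewrite ?inE.
rewrite /l1norm !dec opprD addrACA -!sumrN -!big_split /=.
apply: lerD; apply: ler_sum => i; rewrite !mxE.
  by move=> _; have := ler_normB (b i 0 + h i 0) (h i 0); rewrite addrK; lra.
by rewrite !inE negbK => /eqP ->; rewrite add0r normr0 sub0r.
Qed.

(** * Operator norm of the graph differences *)

(** Summing over the edges counts each vertex as often as its degree: an edge
    is a pair with increasing ends, so the two end points together give every
    ordered adjacent pair exactly once. *)
Lemma sum_edges_le n (G : sgraph n) (x : 'cV[R]_n) :
  \sum_(e in edges G) (x e.1 0 ^+ 2 + x e.2 0 ^+ 2) <= (max_degree G)%:R * sqnorm x.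
Proof.
have -> : \sum_(e in edges G) (x e.1 0 ^+ 2 + x e.2 0 ^+ 2) =
  \sum_(e : 'I_n * 'I_n | G e.1 e.2) x e.1 0 ^+ 2.
  rewrite big_split /=.
  rewrite [RHS](bigID (fun e : 'I_n * 'I_n => (e.1 < e.2)%N)) /=; congr (_ + _).
    by apply: eq_bigl => e; rewrite inE andbC.
  rewrite (reindex_inj (h := fun e : 'I_n * 'I_n => (e.2, e.1))) /=; last first.
    by move=> [a b] [a' b'] [-> ->].
  apply: eq_bigl => -[i j]; rewrite inE /= (adj_sym G j i) andbC -leqNgt.
  case: (boolP (G i j)) => //= Gij.
  by rewrite [RHS]leq_eqVlt; case: eqP => // E; move: Gij; rewrite (val_inj E) (adj_irr G).
rewrite -(pair_big_dep xpredT (fun i j => G i j) (fun i j => x i 0 ^+ 2)) /=.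
rewrite mulr_sumr; apply: ler_sum => i _.
rewrite sumr_const -[_ *+ _]mulr_natl ler_wpM2r ?sqr_ge0 // ler_nat.
have -> : #|[pred j | G i j]| = #|[set j : 'I_n | G i j]%SET| by rewrite cardsE.
exact: (leq_bigmax i).
Qed.

Lemma sqnorm_incidence_le n (G : sgraph n) (x : 'cV[R]_n) :
  sqnorm (incidence R G *m x) <= 2 * (max_degree G)%:R * sqnorm x.
Proof.
rewrite -mulrA; apply: le_trans (ler_wpM2l _ (sum_edges_le G x)) => //.
rewrite /sqnorm mulr_sumr (big_enum_val (fun e : 'I_n * 'I_n => 2 * (x e.1 0 ^+ 2 + x e.2 0 ^+ 2))) /=.
apply: ler_sum => r _.
have -> : (incidence R G *m x) r 0 = x (enum_val r).2 0 - x (enum_val r).1 0.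
  rewrite mxE; set e := enum_val r.
  have ne : e.2 != e.1.
    have := enum_valP r; rewrite -/e inE => /andP[lt _].
    by apply/eqP => E; rewrite E ltnn in lt.
  rewrite (bigD1 e.1) //= (bigD1 e.2) //= big1 => [|v /andP[/negPf v1 /negPf v2]].
    rewrite !mxE -/e /= !eqxx (negPf ne) addr0 mul1r mulN1r; ring.
  by rewrite mxE -/e /= v1 v2 mul0r.
have := sqr_ge0 (x (enum_val r).2 0 + x (enum_val r).1 0); lra.
Qed.

(** A matrix and its transpose have the same operator norm.  This turns the
    bound on the incidence matrix into one on its transpose, whose rows are not
    sparse. *)
Lemma sqnorm_trmx_le m n (A : 'M[R]_(m, n)) (C : R) :
  0 <= C -> (forall x, sqnorm (A *m x) <= C * sqnorm x) ->
  forall y, sqnorm (A^T *m y) <= C * sqnorm y.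
Proof.
move=> C0 H y; set z := A^T *m y.
have [->|z0] := eqVneq (sqnorm z) 0; first by rewrite mulr_ge0 // sqnorm_ge0.
have zp : 0 < sqnorm z by rewrite lt_def z0 sqnorm_ge0.
have E : sqnorm z = (y^T *m (A *m z)) 0 0.
  by rewrite sqnormE /z trmx_mul trmxK -!mulmxA.
rewrite -(ler_pM2r zp); apply: (@le_trans _ _ (sqnorm y * sqnorm (A *m z))).
  by rewrite -expr2 {1}E; exact: cauchy_schwarz_dot.
by rewrite mulrC mulrAC; apply: ler_wpM2r; rewrite ?sqnorm_ge0.
Qed.

(** One step of the recursion is a product with the incidence matrix or with
    its transpose, according to the parity b; both have operator norm at most
    sqrt (2 d). *)
Lemma sqnorm_diffop_step_le n (G : sgraph n) b
    (D : 'M[R]_(if b then n else #|edges G|, n)) (x : 'cV[R]_n) :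
  sqnorm (diffop_step D *m x) <= 2 * (max_degree G)%:R * sqnorm (D *m x).
Proof.
case: b D => D /=; rewrite -mulmxA; first exact: sqnorm_incidence_le.
by apply: sqnorm_trmx_le => [|z]; [rewrite mulr_ge0 | exact: sqnorm_incidence_le].
Qed.

Lemma sqnorm_diffop_le n (G : sgraph n) k (x : 'cV[R]_n) :
  sqnorm (diffop R G k *m x) <= (2 * (max_degree G)%:R) ^+ k.+1 * sqnorm x.
Proof.
elim: k => [|k IH]; first by rewrite expr1; exact: sqnorm_incidence_le.
apply: le_trans (sqnorm_diffop_step_le _ _) _.
by rewrite exprS -[leRHS]mulrA ler_wpM2l // mulr_ge0.
Qed.

Lemma l1norm_diffop_sparse n (G : sgraph n) k s1 (b h : 'cV[R]_n) :
  (l0norm (diffop R G k *m b) <= s1)%N ->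
  l1norm (diffop R G k *m b) - l1norm (diffop R G k *m (b + h)) <=
  Num.sqrt (s1%:R * (2 * (max_degree G)%:R) ^+ k.+1) * l2norm h.
Proof.
move=> bs; rewrite mulmxDr.
apply: le_trans (l1norm_sparse _ _) _.
rewrite lerBlDr; apply: ler_wpDr; first exact: sumr_ge0.
apply: le_trans (sum_norm_set_le _ bs) _.
rewrite sqrtrM ?ler0n // -mulrA ler_wpM2l ?sqrtr_ge0 //.
rewrite -sqrtrM; last by rewrite exprn_ge0 ?mulr_ge0.
by rewrite /l2norm ler_wsqrtr //; exact: sqnorm_diffop_le.
Qed.

(** The weight of the graph penalty is calibrated so that (2 d)^(k+1) cancels
    against the squared operator norm of the difference operator, and
    nu s1 <= s2 turns sqrt s1 into sqrt s2.  For an edgeless graph both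
    quantities vanish, the quotient by 0 being 0. *)
Lemma graph_penalty_le n (G : sgraph n) k s1 s2 nu l (b h : 'cV[R]_n) :
  0 <= nu -> 0 <= l -> (0 < s1)%N -> nu <= s2%:R / s1%:R ->
  (l0norm (diffop R G k *m b) <= s1)%N ->
  l * Num.sqrt (nu / (2 * (max_degree G)%:R) ^+ k.+1) *
   (l1norm (diffop R G k *m b) - l1norm (diffop R G k *m (b + h))) <=
  l * (Num.sqrt s2%:R * l2norm h).
Proof.
move=> nu0 l0 s10 nus bs; rewrite -mulrA ler_wpM2l //.
apply: le_trans (ler_wpM2l (sqrtr_ge0 _) (l1norm_diffop_sparse _ bs)) _.
set t := _ ^+ k.+1; have t0 : 0 <= t by rewrite exprn_ge0 ?mulr_ge0.
rewrite mulrA ler_wpM2r ?l2norm_ge0 // -sqrtrM ?divr_ge0 // ler_wsqrtr //.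
rewrite ler_pdivlMr ?ltr0n // in nus.
have [->|tn0] := eqVneq t 0; first by rewrite !mulr0 ler0n.
by have -> : nu / t * (s1%:R * t) = nu * s1%:R by field.
Qed.

(** * The Lasso inequality *)

Lemma sqnorm_subM N n (X : 'M[R]_(N, n)) (e : 'cV[R]_N) (h : 'cV[R]_n) :
  sqnorm (e - X *m h) = sqnorm e - 2 * (e^T *m (X *m h)) 0 0 + sqnorm (X *m h).
Proof.
rewrite dotmxE /sqnorm mulr_sumr -sumrN -!big_split /=; apply: eq_bigr => i _.
set u := X *m h; rewrite !mxE; ring.
Qed.

(** Optimality against the single competitor b; the residual at b is the noise
    e, and expanding the square of e - X h leaves the cross term. *)
Lemma gpp_basic_inequality (N n : nat) (G : sgraph n) k (l lg : R)
  (X : 'M[R]_(N, n)) (e : 'cV[R]_N) (b h : 'cV[R]_n) : (0 < N)%N ->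
  gpp_lasso G k l lg X (X *m b + e) (b + h) ->
  (2 * N%:R)^-1 * sqnorm (X *m h) <=
    N%:R^-1 * (e^T *m (X *m h)) 0 0
    + lg * (l1norm (diffop R G k *m b) - l1norm (diffop R G k *m (b + h)))
    + l * (l1norm b - l1norm (b + h)).
Proof.
move=> N0 /(_ b); rewrite /gpp_objective !sqr_l2norm => H.
have E1 : X *m b + e - X *m (b + h) = e - X *m h.
  by rewrite mulmxDr opprD addrACA subrr add0r.
have E2 : X *m b + e - X *m b = e by rewrite addrC addKr.
move: H; rewrite E1 E2 sqnorm_subM.
have -> : (2 * N%:R)^-1 = 2^-1 * N%:R^-1 :> R by rewrite invfM.
set u := N%:R^-1; set a := sqnorm _; set d := _ 0 0; set f := sqnorm _.
move=> H; have -> : u * d = 2^-1 * u * (2 * d) by field.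
lra.
Qed.

(** The cross term is at most the sup norm of X^T e / N times the l1 norm of
    h, and the two penalty terms are those of graph_penalty_le and
    l1norm_sparse. *)
Lemma gpp_support_inequality (N n : nat) (G : sgraph n) k s1 s2 nu l B
  (X : 'M[R]_(N, n)) (e : 'cV[R]_N) (b h : 'cV[R]_n) :
  (0 < N)%N -> (0 < s1)%N -> 0 <= nu -> 0 <= l -> nu <= s2%:R / s1%:R ->
  param_space G k s1 s2 b ->
  gpp_lasso G k l (l * Num.sqrt (nu / (2 * (max_degree G)%:R) ^+ k.+1)) X (X *m b + e) (b + h) ->
  (forall j, `|(X^T *m e) j 0| <= N%:R * (B * l)) ->
  (2 * N%:R)^-1 * sqnorm (X *m h) <=
   l * (B * l1norm h + Num.sqrt s2%:R * l2norm h
     + (\sum_(i in [set i | b i 0 != 0]%SET) `|h i 0|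
        - \sum_(i in ~: [set i | b i 0 != 0]%SET) `|h i 0|)).
Proof.
move=> N0 s10 nu0 l0 nus [bs1 bs2] Hl He.
apply: le_trans (gpp_basic_inequality N0 Hl) _.
rewrite [leRHS]mulrDr; apply: lerD; first (rewrite [leRHS]mulrDr; apply: lerD).
- have -> : e^T *m (X *m h) = (X^T *m e)^T *m h by rewrite trmx_mul trmxK mulmxA.
  rewrite dotmxE mulrC ler_pdivrMr ?ltr0n //.
  have -> : l * (B * l1norm h) * N%:R = \sum_i N%:R * (B * l) * `|h i 0|.
    by rewrite -mulr_sumr -/(l1norm h); ring.
  apply: ler_sum => i _; apply: le_trans (ler_norm _) _.
  by rewrite normrM ler_wpM2r.
- by apply: graph_penalty_le nus bs1.
- by rewrite ler_wpM2l //; exact: l1norm_sparse.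
Qed.

(** The constant kap bounds the ratio of l1 norm to sqrt s2 times l2 norm.  It is
    either forced by the noise level 1/2 (then kap = 6 is enough) or supplied from
    outside; the restricted eigenvalue a is needed only under the resulting
    inequality. *)
Lemma gpp_rate (N n : nat) (G : sgraph n) k s1 s2 nu l B kap a
  (X : 'M[R]_(N, n)) (e : 'cV[R]_N) (b h : 'cV[R]_n) :
  (0 < N)%N -> (0 < s1)%N -> 0 <= nu -> 0 < l -> 0 < a -> 0 <= B -> 0 <= kap ->
  nu <= s2%:R / s1%:R ->
  param_space G k s1 s2 b ->
  gpp_lasso G k l (l * Num.sqrt (nu / (2 * (max_degree G)%:R) ^+ k.+1)) X (X *m b + e) (b + h) ->
  (forall j, `|(X^T *m e) j 0| <= N%:R * (B * l)) ->
  let r := Num.sqrt s2%:R in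
  (B = 2^-1 /\ 6 <= kap \/ l1norm h <= kap * (r * l2norm h)) ->
  (l1norm h <= kap * (r * l2norm h) -> a * sqnorm h <= N%:R^-1 * sqnorm (X *m h)) ->
  let K := 2 * (B * kap + 2) in
  [/\ l2norm h <= K / a * (l * r),
      l1norm h <= kap * (K / a) * (l * r ^+ 2) &
      N%:R^-1 * sqnorm (X *m h) <= K ^+ 2 / a * (l * r) ^+ 2].
Proof.
move=> N0 s10 nu0 l0 a0 B0 kap0 nus bS Hl He r Hcone Hre K.
have /= := gpp_support_inequality N0 s10 nu0 (ltW l0) nus bS Hl He.
rewrite -/r; set Sm := \sum_(i in _) _; set Sc := \sum_(i in ~: _) _ => H.
have Sm0 : 0 <= Sm by exact: sumr_ge0.
have Sc0 : 0 <= Sc by exact: sumr_ge0.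
have h1 : l1norm h = Sm + Sc.
  by rewrite /l1norm /Sm /Sc (bigID (mem [set i | b i 0 != 0]%SET)) /=; congr (_ + _);
     apply: eq_bigl => i; rewrite !inE.
have Sr : Sm <= r * l2norm h by apply: sum_norm_set_le; case: bS.
have Xh0 := sqnorm_ge0 (X *m h).
have H0 : 0 <= (2 * N%:R)^-1 * sqnorm (X *m h) by rewrite mulr_ge0 // invr_ge0 mulr_ge0.
have Hk : l1norm h <= kap * (r * l2norm h).
  (* For B = 1/2 the factor 1/2 of the l1 norm of h on the complement of the
     support is absorbed: Sc <= 3 Sm + 2 r |h| and Sm <= r |h|. *)
  case: Hcone => // -[EB k6].
  have := le_trans H0 H; rewrite pmulr_rge0 // EB h1 => HH.
  have : 6 * (r * l2norm h) <= kap * (r * l2norm h) by apply: ler_wpM2r => //; lra.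
  lra.
have {}Hre := Hre Hk.
have H2 : N%:R^-1 * sqnorm (X *m h) <= K * (l * r) * l2norm h.
  have -> : N%:R^-1 * sqnorm (X *m h) = 2 * ((2 * N%:R)^-1 * sqnorm (X *m h)).
    by field; rewrite pnatr_eq0 -lt0n.
  rewrite /K -!mulrA ler_wpM2l //; apply: le_trans H _.
  rewrite [leRHS]mulrCA ler_wpM2l ?(ltW l0) //.
  have := ler_wpM2l B0 Hk; lra.
have L0 := l2norm_ge0 h.
have r0 : 0 <= r by exact: sqrtr_ge0.
have K0 : 0 <= K by rewrite /K; have := mulr_ge0 B0 kap0; lra.
have Hl2 : l2norm h <= K / a * (l * r).
  have := le_trans Hre H2; rewrite -sqr_l2norm expr2 [X in X <= _]mulrA.
  have [-> _|hn0] := eqVneq (l2norm h) 0.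
    by apply: mulr_ge0; [apply: divr_ge0 | apply: mulr_ge0] => //; exact: ltW.
  rewrite ler_pM2r; last by rewrite lt_def hn0.
  by rewrite mulrC -ler_pdivlMr // mulrAC.
split => //.
- apply: le_trans Hk _; rewrite -mulrA ler_wpM2l //.
  by apply: le_trans (ler_wpM2l r0 Hl2) _; rewrite expr2; rewrite le_eqVlt; apply/orP; left; apply/eqP; ring.
- apply: le_trans H2 _; apply: le_trans (ler_wpM2l _ Hl2) _.
    by apply: mulr_ge0 => //; apply: mulr_ge0 => //; exact: ltW.
  by rewrite le_eqVlt; apply/orP; left; apply/eqP; ring.
Qed.

(** * Quadratic forms on sums of signed basis vectors *)

Definition bform n (M : 'M[R]_n) (u v : 'cV[R]_n) : R := (u^T *m M *m v) 0 0.

Lemma bformDl n (M : 'M[R]_n) u1 u2 v : bform M (u1 + u2) v = bform M u1 v + bform M u2 v.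
Proof. by rewrite /bform linearD /= !mulmxDl mxE. Qed.
Lemma bformDr n (M : 'M[R]_n) u v1 v2 : bform M u (v1 + v2) = bform M u v1 + bform M u v2.
Proof. by rewrite /bform mulmxDr mxE. Qed.
Lemma bformZl n (M : 'M[R]_n) a u v : bform M (a *: u) v = a * bform M u v.
Proof. by rewrite /bform linearZ /= -!scalemxAl mxE. Qed.
Lemma bformZr n (M : 'M[R]_n) a u v : bform M u (a *: v) = a * bform M u v.
Proof. by rewrite /bform -scalemxAr mxE. Qed.
Lemma bform0l n (M : 'M[R]_n) v : bform M 0 v = 0.
Proof. by rewrite /bform trmx0 !mul0mx mxE. Qed.
Lemma bform0r n (M : 'M[R]_n) v : bform M v 0 = 0.
Proof. by rewrite /bform mulmx0 mxE. Qed.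
Lemma bform_suml n (M : 'M[R]_n) (I : finType) (u : I -> 'cV[R]_n) v :
  bform M (\sum_i u i) v = \sum_i bform M (u i) v.
Proof. by rewrite (big_morph (bform M ^~ v) (fun a b => bformDl M a b v) (bform0l M v)). Qed.
Lemma bform_sumr n (M : 'M[R]_n) (I : finType) (u : I -> 'cV[R]_n) v :
  bform M v (\sum_i u i) = \sum_i bform M v (u i).
Proof. by rewrite (big_morph (bform M v) (bformDr M v) (bform0r M v)). Qed.

Definition signed_basis n (b : bool * 'I_n) : 'cV[R]_n := (-1) ^+ b.1 *: delta_mx b.2 0.

Lemma bform_signed_basis n (M : 'M[R]_n) b : bform M (signed_basis b) (signed_basis b) = M b.2 b.2.
Proof.
rewrite bformZl bformZr mulrA -expr2 sqrr_sign mul1r /bform.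
by rewrite trmx_delta -rowE -colE !mxE.
Qed.

Lemma sum_signed_basis n (x : 'cV[R]_n) :
  x = \sum_j `|x j 0| *: signed_basis (x j 0 < 0, j).
Proof.
rewrite [LHS]matrix_sum_delta; apply: eq_bigr => j _.
by rewrite big_ord1 scalerA mulrC -realEsign ?num_real.
Qed.

(** Maurey's empirical method, one sample at a time.  Draw the coordinate j with
    probability |x_j| and add the basis vector e_j with the sign of x_j; the mean
    of one sample is x.  The expression in the conclusion is the mean of the form at
    w plus m independent samples: the off-diagonal pairs contribute the form at x, and
    each diagonal term contributes a mean of diagonal entries of M.  Letting w
    move makes the induction on m go through without product weights. *)
Lemma averaging_over_signed_basis n (M : 'M[R]_n) (x : 'cV[R]_n) m (w : 'cV[R]_n) :
  l1norm x = 1 ->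
  (forall s : seq (bool * 'I_n), size s = m ->
     0 <= bform M (w + \sum_(b <- s) signed_basis b) (w + \sum_(b <- s) signed_basis b)) ->
  0 <= bform M w w + m%:R * (bform M w x + bform M x w)
     + m%:R * (\sum_j `|x j 0| * M j j) + m%:R * (m%:R - 1) * bform M x x.
Proof.
move=> x1; elim: m w => [|m IH] w Hw.
  by have := Hw [::] erefl; rewrite /= big_nil !addr0 !mul0r !addr0.
pose e j := signed_basis (x j 0 < 0, j).
have xE : x = \sum_j `|x j 0| *: e j by exact: sum_signed_basis.
set T := \sum_j _ * M j j.
have Hj j : 0 <= bform M (w + e j) (w + e j)
     + m%:R * (bform M (w + e j) x + bform M x (w + e j))
     + m%:R * T + m%:R * (m%:R - 1) * bform M x x.
  apply: IH => s sm; rewrite -addrA.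
  have := Hw ((x j 0 < 0, j) :: s); rewrite /= sm => /(_ erefl).
  by rewrite big_cons.
have : 0 <= \sum_j `|x j 0| * (bform M (w + e j) (w + e j)
     + m%:R * (bform M (w + e j) x + bform M x (w + e j))
     + m%:R * T + m%:R * (m%:R - 1) * bform M x x).
  by apply: sumr_ge0 => j _; apply: mulr_ge0.
have Bl (y : 'cV[R]_n) : \sum_j `|x j 0| * bform M (e j) y = bform M x y.
  by rewrite [in RHS]xE bform_suml; apply: eq_bigr => j _; rewrite [RHS]bformZl.
have Br (y : 'cV[R]_n) : \sum_j `|x j 0| * bform M y (e j) = bform M y x.
  by rewrite [in RHS]xE bform_sumr; apply: eq_bigr => j _; rewrite [RHS]bformZr.
have BT : \sum_j `|x j 0| * bform M (e j) (e j) = T.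
  by apply: eq_bigr => j _; rewrite bform_signed_basis.
rewrite (eq_bigr (fun j => `|x j 0| * (bform M w w + m%:R * (bform M w x + bform M x w)
   + m%:R * T + m%:R * (m%:R - 1) * bform M x x)
   + (`|x j 0| * bform M w (e j) + `|x j 0| * bform M (e j) w
   + `|x j 0| * bform M (e j) (e j)
   + m%:R * (`|x j 0| * bform M (e j) x + `|x j 0| * bform M x (e j))))); last first.
  by move=> j _; rewrite !bformDl !bformDr; ring.
rewrite !big_split /= -mulr_suml -/(l1norm x) x1 -mulr_sumr !big_split /= !Bl !Br BT.
rewrite -natr1; lra.
Qed.

(** The averaging identity at w = 0 with q + 1 samples, after scaling x to unit
    l1 norm. *)
Lemma restricted_form_ge n (M : 'M[R]_n) (D : R) q (x : 'cV[R]_n) :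
  (forall j, M j j <= D) ->
  (forall s : q.+1.-tuple (bool * 'I_n),
     0 <= bform M (\sum_(b <- s) signed_basis b) (\sum_(b <- s) signed_basis b)) ->
  0 <= q%:R * bform M x x + D * l1norm x ^+ 2.
Proof.
move=> HD HM; have [x0|x0] := eqVneq (l1norm x) 0.
  by rewrite x0 (l1norm_eq0 x0) bform0l expr0n !mulr0 addr0.
have xp : 0 < l1norm x by rewrite lt_def x0 l1norm_ge0.
pose y := (l1norm x)^-1 *: x.
have y1 : l1norm y = 1.
  rewrite /l1norm; under eq_bigr do rewrite mxE normrM.
  by rewrite -mulr_sumr ger0_norm ?invr_ge0 ?l1norm_ge0 // mulVf.
have xE : x = l1norm x *: y by rewrite scalerA divff // scale1r.
clearbody y; have H := @averaging_over_signed_basis n M y q.+1 0 y1.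
rewrite bform0l bform0r bform0l in H.
have : 0 <= q.+1%:R * (q%:R * bform M y y + D).
  apply: (le_trans (H _)) => [s sq|].
    rewrite add0r.
    have := HM (Tuple (introT eqP sq)); exact.
  have : \sum_j `|y j 0| * M j j <= D.
    rewrite -[leRHS]mul1r -y1 mulr_suml; apply: ler_sum => j _.
    by rewrite ler_wpM2l.
  have q0 : 0 <= q.+1%:R :> R by [].
  move=> /(ler_wpM2l q0); rewrite -natr1; lra.
rewrite pmulr_rge0 ?ltr0n // => HH.
have -> : bform M x x = l1norm x * (l1norm x * bform M y y).
  by rewrite {1 2}xE bformZl bformZr.
have -> : q%:R * (l1norm x * (l1norm x * bform M y y)) + D * l1norm x ^+ 2 =
  (q%:R * bform M y y + D) * l1norm x ^+ 2 by ring.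
by rewrite mulr_ge0 ?sqr_ge0.
Qed.

Lemma bformE n (M : 'M[R]_n) u v : bform M u v = (u^T *m (M *m v)) 0 0.
Proof. by rewrite /bform mulmxA. Qed.

Lemma bform_subscalar n (M : 'M[R]_n) a u : bform (M - a%:M) u u = bform M u u - a * sqnorm u.
Proof.
by rewrite !bformE mulmxBl mul_scalar_mx mulmxBr -scalemxAr !mxE sqnormE [(u^T *m u) 0 0]mxE.
Qed.

(** restricted_form_ge for the matrix X^T X / N - a I. *)
Lemma restricted_eigenvalue N n (X : 'M[R]_(N, n)) (a D : R) q (x : 'cV[R]_n) :
  0 <= a -> (0 < N)%N ->
  (forall j, \sum_i X i j ^+ 2 <= D * N%:R) ->
  (forall s : q.+1.-tuple (bool * 'I_n),
     a * sqnorm (\sum_(b <- s) signed_basis b) <=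
     N%:R^-1 * sqnorm (X *m \sum_(b <- s) signed_basis b)) ->
  q%:R * (a * sqnorm x) <= q%:R * (N%:R^-1 * sqnorm (X *m x)) + D * l1norm x ^+ 2.
Proof.
move=> a0 N0 HD HV.
pose M := (N%:R^-1 *: (X^T *m X)) - a%:M.
have ME v : bform M v v = N%:R^-1 * sqnorm (X *m v) - a * sqnorm v.
  rewrite bform_subscalar; congr (_ - _).
  rewrite bformE -scalemxAl -scalemxAr mxE; congr (_ * _).
  by rewrite sqnormE trmx_mul -!mulmxA.
suff : 0 <= q%:R * bform M x x + D * l1norm x ^+ 2 by rewrite ME; lra.
apply: restricted_form_ge => [j|s]; last by rewrite ME subr_ge0.
rewrite !mxE eqxx mulr1n; apply: (@le_trans _ _ (N%:R^-1 * (D * N%:R))).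
  rewrite lerBlDr; apply: ler_wpDr => //; rewrite ler_wpM2l ?invr_ge0 //.
  apply: le_trans (HD j); rewrite le_eqVlt; apply/orP; left; apply/eqP.
  by apply: eq_bigr => i _; rewrite mxE expr2.
by rewrite mulrC mulfK // pnatr_eq0 -lt0n.
Qed.
(** * The smallest eigenvalue *)

Lemma sym_bformC n (M : 'M[R]_n) u v : M^T = M -> bform M u v = bform M v u.
Proof.
move=> Ms; rewrite /bform -[in LHS](trmxK (u^T *m M *m v)) mxE.
by rewrite !trmx_mul trmxK Ms mulmxA.
Qed.

(** The form is nonnegative on the plane spanned by u and v; up to a factor, the
    combinations used are its minimizers on the lines u + R v and R u + v. *)
Lemma psd_cauchy_schwarz n (M : 'M[R]_n) u v : M^T = M ->
  (forall x, 0 <= bform M x x) -> bform M u v ^+ 2 <= bform M u u * bform M v v.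
Proof.
move=> Ms Mp.
have H a b : 0 <= a ^+ 2 * bform M u u + 2 * a * b * bform M u v + b ^+ 2 * bform M v v.
  have := Mp (a *: u + b *: v).
  rewrite !bformDl !bformDr !bformZl !bformZr (sym_bformC v u Ms); lra.
have := H (bform M v v) (- bform M u v); have := H (- bform M u v) (bform M u u).
have := Mp u; have := Mp v.
set p := bform M u u; set q := bform M v v; set r := bform M u v => q0 p0 H1 H2.
have [p00|pn0] := eqVneq p 0.
  have [q00|qn0] := eqVneq q 0.
    have := H 1 (- r); rewrite -/p -/q -/r p00 q00; lra.
  have qp : 0 < q by rewrite lt_def qn0.
  have : 0 <= q * (p * q - r ^+ 2) by lra.
  by rewrite pmulr_rge0 // subr_ge0.
have pp : 0 < p by rewrite lt_def pn0.
have : 0 <= p * (p * q - r ^+ 2) by lra.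
by rewrite pmulr_rge0 // subr_ge0.
Qed.

(** The infimum mu of the form on the unit sphere is itself an eigenvalue.
    Otherwise S - mu is invertible and positive semidefinite, so that
    |u|^2 <= C' |(S - mu) u|^2 <= C' C ((S - mu) u, u) by Cauchy-Schwarz for that
    form, and the infimum would be at least mu + 1 / (C' C). *)
Lemma min_eigenvalue_le n (S : 'M[R]_n) (c : R) : (0 < n)%N -> S^T = S ->
  (forall x, eigenvalue S x -> c <= x) -> forall u, c * sqnorm u <= bform S u u.
Proof.
move=> n0 Ss Hc.
(* The Frobenius norm is a crude but sufficient bound of the operator norm. *)
pose F (A : 'M[R]_n) : R := \sum_i \sum_j A i j ^+ 2.
have F0 A : 0 <= F A by do 2!(apply: sumr_ge0 => ? _); exact: sqr_ge0.
have bform_le A u : `|bform A u u| <= (F A + 1) * sqnorm u.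
  rewrite -(ler_pXn2r (ltn0Sn 1)) ?nnegrE ?mulr_ge0 ?addr_ge0 ?sqnorm_ge0 //.
  rewrite real_normK ?num_real // bformE.
  apply: le_trans (cauchy_schwarz_dot _ _) _.
  apply: le_trans (ler_wpM2l (sqnorm_ge0 _) (sqnorm_mulmx_le A u)) _.
  rewrite -/(F A) exprMn mulrCA -expr2; apply: ler_wpM2r; rewrite ?sqr_ge0 //.
  have := F0 A; nra.
pose E : set R := [set bform S u u | u in [set u : 'cV[R]_n | sqnorm u = 1]].
have Einf : has_inf E.
  split.
    pose e : 'cV[R]_n := delta_mx (Ordinal n0) 0.
    exists (bform S e e); exists e => //=.
    rewrite /sqnorm (bigD1 (Ordinal n0)) //= big1 => [|i /negPf ni].
      by rewrite mxE !eqxx expr1n addr0.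
    by rewrite mxE ni expr0n.
  exists (- (F S + 1)) => _ [u /= u1 <-].
  have := bform_le S u; rewrite u1 mulr1; by rewrite ler_norml => /andP[].
pose mu := inf E.
have muP u : mu * sqnorm u <= bform S u u.
  have [u0|u0] := eqVneq (sqnorm u) 0.
    by rewrite (sqnorm_eq0 u0) bform0l /sqnorm big1 ?mulr0 // => i _; rewrite mxE expr0n.
  have up : 0 < sqnorm u by rewrite lt_def u0 sqnorm_ge0.
  pose t := (Num.sqrt (sqnorm u))^-1.
  have t2 : t ^+ 2 = (sqnorm u)^-1 by rewrite exprVn sqr_sqrtr // sqnorm_ge0.
  rewrite -ler_pdivlMr // mulrC -t2 expr2 -mulrA -bformZr -bformZl.
  apply: ge_inf; first by case: Einf.
  by exists (t *: u) => //=; rewrite sqnormZ t2 mulVf.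
suff muE : eigenvalue S mu.
  by move=> u; apply: le_trans (muP u); apply: ler_wpM2r; [exact: sqnorm_ge0|exact: Hc].
pose B := S - mu%:M.
rewrite /eigenvalue /eigenspace -/B; apply/negP => /eqP kB.
have Bu : B \in unitmx by rewrite -row_free_unit -kermx_eq0 kB.
have Bs : B^T = B by rewrite /B linearB /= Ss tr_scalar_mx.
have Bp x : 0 <= bform B x x by rewrite bform_subscalar subr_ge0.
pose C := F B + 1; pose C' := F (invmx B) + 1.
have C0 : 0 < C by rewrite ltr_wpDl.
have C'0 : 0 < C' by rewrite ltr_wpDl.
have H1 x : sqnorm (B *m x) <= C * bform B x x.
  have [z0|z0] := eqVneq (sqnorm (B *m x)) 0; first by rewrite z0 mulr_ge0 ?(ltW C0).
  have zp : 0 < sqnorm (B *m x) by rewrite lt_def z0 sqnorm_ge0.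
  have := psd_cauchy_schwarz (B *m x) x Bs Bp; rewrite {1}bformE -sqnormE => H.
  have H' := le_trans (ler_norm _) (bform_le B (B *m x)).
  have := le_trans H (ler_wpM2r (Bp x) H').
  by rewrite expr2 -/C -[leRHS]mulrA [leRHS]mulrC -[leRHS]mulrA ler_pM2l // mulrC.
have H2 x : sqnorm x <= C' * (C * bform B x x).
  apply: le_trans (ler_wpM2l (ltW C'0) (H1 x)).
  rewrite -[x in leLHS](mulKmx Bu).
  apply: le_trans (sqnorm_mulmx_le _ _) _; rewrite ler_wpM2r ?sqnorm_ge0 //.
  by rewrite lerDl.
have : mu + (C' * C)^-1 <= mu.
  apply: lb_le_inf; first by case: Einf.
  move=> _ [u /= u1 <-]; have := H2 u; rewrite bform_subscalar u1 mulr1 mulrA.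
  by rewrite -ler_pdivrMl ?mulr_gt0 // mulr1 lerBrDl addrC.
by rewrite gerDl leNgt invr_gt0 mulr_gt0.
Qed.
End Norms.

(** * Expectations of independent variables *)

Section Indep.
Context d (T : measurableType d) (R : realType) (P : probability T R).
Import HBNNSimple.

(** The weighted law of Y is dominated by a multiple of its law on every
    measurable set, hence also when nonnegative functions are integrated: pass
    through simple functions and monotone convergence. *)
Lemma integral_weighted_le d' (U : measurableType d') (Y : T -> U) (G : T -> R) (C : \bar R)
    (h : U -> R) :
  measurable_fun setT Y -> measurable_fun setT G -> (forall w, 0 <= G w) -> (0 <= C)%E ->
  measurable_fun setT h -> (forall u, 0 <= h u) ->
  (forall A, measurable A ->
     (\int[P]_w (G w * \1_A (Y w))%:E <= C * \int[P]_w (\1_A (Y w))%:E)%E) ->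
  (\int[P]_w (G w * h (Y w))%:E <= C * \int[P]_w (h (Y w))%:E)%E.
Proof.
move=> mY mG G0 C0 mh h0 HA.
have mh' : measurable_fun setT (EFin \o h) by exact/measurable_EFinP.
pose f := nnsfun_approx measurableT mh'.
have mI A : measurable A -> measurable_fun setT (fun w => (\1_A (Y w) : R)).
  by move=> mA; apply: (@measurableT_comp _ _ _ _ _ _ (\1_A : U -> R)).
have fnd a b u : (a <= b)%N -> f a u <= f b u.
  by move=> ab; move: u; apply/lefP/nd_nnsfun_approx.
have mf n : measurable_fun setT (fun w => f n (Y w)).
  by apply: (@measurableT_comp _ _ _ _ _ _ (f n)).
have fh n u : f n u <= h u.
  rewrite -lee_fin /f nnsfun_approxE.
  exact: (@le_approx _ _ _ setT (EFin \o h) n u (fun x _ => h0 x)).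
have simple n : (\int[P]_w (G w * f n (Y w))%:E <= C * \int[P]_w (f n (Y w))%:E)%E.
  pose s := fset_set (f n @` setT).
  have s0 (i : 'I_#|`s|) : 0 <= s`_i.
    have : s`_i \in s by rewrite mem_nth.
    by rewrite in_fset_set; [move=> /set_mem[x _ <-] | exact: fimfunP].
  have mA (i : 'I_#|`s|) : measurable (f n @^-1` [set s`_i]).
    exact: measurable_sfunP.
  rewrite [X in (X <= _)%E](_ : _ = \sum_(i < #|`s|) (s`_i)%:E *
      \int[P]_w (G w * \1_(f n @^-1` [set s`_i]) (Y w))%:E)%E; last first.
    have E (i : 'I_#|`s|) : ((s`_i)%:E * \int[P]_w (G w * \1_(f n @^-1` [set s`_i]) (Y w))%:E =
        \int[P]_w (s`_i * (G w * \1_(f n @^-1` [set s`_i]) (Y w)))%:E)%E.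
      rewrite -ge0_integralZl_EFin ?s0 //; first by move=> w _; rewrite lee_fin mulr_ge0.
      by apply/measurable_EFinP; apply: measurable_funM => //; exact: mI.
    rewrite (eq_bigr _ (fun i _ => E i)).
    rewrite -ge0_integral_sum //; last 2 first.
    - move=> i; apply/measurable_EFinP; apply: measurable_funM => //.
      by apply: measurable_funM => //; exact: mI.
    - by move=> i w _; rewrite lee_fin !mulr_ge0.
    apply: eq_integral => w _; rewrite fimfunEord sumEFin; congr EFin.
    by rewrite mulr_sumr; apply: eq_bigr => i _; rewrite mulrCA.
  rewrite [X in (_ <= _ * X)%E](_ : _ = \sum_(i < #|`s|) (s`_i)%:E *
      \int[P]_w (\1_(f n @^-1` [set s`_i]) (Y w))%:E)%E; last first.
    have E (i : 'I_#|`s|) : ((s`_i)%:E * \int[P]_w (\1_(f n @^-1` [set s`_i]) (Y w))%:E =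
        \int[P]_w (s`_i * \1_(f n @^-1` [set s`_i]) (Y w))%:E)%E.
      rewrite -ge0_integralZl_EFin ?s0 //.
      by apply/measurable_EFinP; exact: mI.
    rewrite (eq_bigr _ (fun i _ => E i)).
    rewrite -ge0_integral_sum //; last 2 first.
    - by move=> i; apply/measurable_EFinP; apply: measurable_funM => //; exact: mI.
    - by move=> i w _; rewrite lee_fin !mulr_ge0.
    by apply: eq_integral => w _; rewrite fimfunEord sumEFin.
  rewrite ge0_sume_distrr; last first.
    by move=> i _; rewrite mule_ge0 ?lee_fin ?s0 // integral_ge0.
  apply: lee_sum => i _; rewrite muleCA; apply: lee_wpmul2l; first by rewrite lee_fin s0.
  exact: HA.
rewrite [X in (X <= _)%E](_ : _ = limn (fun n => \int[P]_w (G w * f n (Y w))%:E)%E); last first.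
  rewrite -monotone_convergence //.
  - apply: eq_integral => w _; apply/esym/cvg_lim => //.
    under eq_fun do rewrite EFinM.
    rewrite EFinM; apply: cvgeZl => //.
    exact: (@cvg_nnsfun_approx _ _ _ _ measurableT _ mh' (fun x _ => h0 x) (Y w) Logic.I).
  - by move=> n; apply/measurable_EFinP; exact: measurable_funM.
  - by move=> n w _; rewrite lee_fin mulr_ge0.
  - move=> w _ a b ab; rewrite lee_fin ler_wpM2l //; exact: fnd.
apply: lime_le.
  apply: ereal_nondecreasing_is_cvgn => a b ab.
  apply: ge0_le_integral => //.
  - by move=> w _; rewrite lee_fin mulr_ge0.
  - by apply/measurable_EFinP; exact: measurable_funM.
  - by apply/measurable_EFinP; exact: measurable_funM.
  - move=> w _; rewrite lee_fin ler_wpM2l //; exact: fnd.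
apply: nearW => n; apply: le_trans (simple n) _.
apply: lee_wpmul2l => //; apply: ge0_le_integral => //.
- by move=> w _; rewrite lee_fin.
- by apply/measurable_EFinP.
- by apply/measurable_EFinP; exact: measurableT_comp.
- by move=> w _; rewrite lee_fin.
Qed.

(** Mutual independence is a product rule for indicators.  The indicators are
    exchanged for the functions g i one index at a time; each exchange is
    integral_weighted_le with the product of the other factors as weight.  An
    inequality is enough for Chernoff bounds. *)
Lemma expectation_prod_indep_le d' (U : measurableType d') N (Y : 'I_N -> T -> U)
    (g : 'I_N -> U -> R) :
  (forall i, measurable_fun setT (Y i)) -> mutual_indep P Y ->
  (forall i, measurable_fun setT (g i)) -> (forall i u, 0 <= g i u) ->
  (\int[P]_w (\prod_i g i (Y i w))%:E <= \prod_i \int[P]_w (g i (Y i w))%:E)%E.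
Proof.
move=> mY indY.
(* Only the factors of index below k are general; the others are indicators. *)
suff H k (h : 'I_N -> U -> R) : (forall i, measurable_fun setT (h i)) -> (forall i u, 0 <= h i u) ->
    (forall i : 'I_N, (k <= i)%N -> exists2 A : set U, measurable A & h i = \1_A) ->
    (\int[P]_w (\prod_i h i (Y i w))%:E <= \prod_i \int[P]_w (h i (Y i w))%:E)%E.
  by move=> mg g0; apply: (H N) => // i; rewrite leqNgt ltn_ord.
elim: k h => [|k IH] h mh h0 hA.
  have {hA}/boolp.choice[A hA] i : exists A : set U, measurable A /\ h i = \1_A.
    by have [A mA hi] := hA i isT; exists A.
  rewrite (eq_integral (fun w => (\1_(\bigcap_(i in [set: 'I_N]) (Y i @^-1` A i)) w)%:E)).
    rewrite integral_indic //; last first.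
      apply: fin_bigcap_measurable => // i _.
      by rewrite -[X in measurable X]setTI; apply: mY => //; exact: (hA i).1.
    rewrite setIT [X in (X <= _)%E](indY A (fun i => (hA i).1)).
    rewrite le_eqVlt; apply/orP; left; apply/eqP; apply: eq_bigr => i _.
    rewrite (hA i).2 [RHS](_ : _ = \int[P]_w (\1_(Y i @^-1` A i) w)%:E)%E //.
    rewrite integral_indic ?setIT //.
    by rewrite -[X in measurable X]setTI; apply: mY => //; exact: (hA i).1.
  move=> w _; congr EFin; rewrite indicE.
  case: (boolP (w \in _)) => [/set_mem wA|].
    by apply: big1 => i _; rewrite (hA i).2 indicE mem_set //; exact: wA.
  rewrite notin_setE => wA.
  have [i Hi] : exists i, ~ A i (Y i w) by apply: contrapT => /forallNP H; apply: wA => i _; apply: contrapT; exact: H.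
  by rewrite (bigD1 i) //= (hA i).2 indicE memNset // mul0r.
have [kN|Nk] := ltnP k N; last first.
  by apply: IH => // i ki; exfalso; have := leq_ltn_trans (leq_trans Nk ki) (ltn_ord i); rewrite ltnn.
pose i0 := Ordinal kN.
have mhY i : measurable_fun setT (fun w => h i (Y i w)).
  by apply: (@measurableT_comp _ _ _ _ _ _ (h i)).
rewrite (bigD1 i0) //= muleC.
under eq_integral do rewrite (bigD1 i0) //= mulrC.
apply: (integral_weighted_le (mY i0)) => //.
- by under eq_fun do rewrite -big_filter; apply: measurable_prod => i _.
- by move=> w; apply: prodr_ge0.
- by apply: prode_ge0 => i _; apply: integral_ge0 => w _; rewrite lee_fin.
move=> A mA; pose h' i := if i == i0 then \1_A else h i.
have h'0 : h' i0 = \1_A by rewrite /h' eqxx.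
have h'N i : i != i0 -> h' i = h i by rewrite /h' => /negPf ->.
have EC : (\prod_(i | i != i0) \int[P]_w (h' i (Y i w))%:E =
    \prod_(i | i != i0) \int[P]_w (h i (Y i w))%:E)%E.
  by apply: eq_bigr => i /h'N ->.
have := IH h'; rewrite (bigD1 i0) //= h'0 EC muleC => H; apply: le_trans (H _ _ _).
- rewrite le_eqVlt; apply/orP; left; apply/eqP; apply: eq_integral => w _; congr EFin.
  rewrite [RHS](bigD1 i0) //= h'0 [RHS]mulrC; congr (_ * _).
  by apply: eq_bigr => i /h'N ->.
- by move=> i; rewrite /h'; case: ifP => _; [exact: measurable_indic | exact: mh].
- by move=> i u; rewrite /h'; case: ifP.
- move=> i ki; have [->|ni] := eqVneq i i0; first by exists A.
  rewrite h'N //; apply: hA; rewrite ltn_neqAle ki andbT.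
  by apply: contra ni => /eqP E; apply/eqP/val_inj; rewrite /= -E.
Qed.

(** By independence the law of (Y, Z) is the product of the two laws, and
    Tonelli's theorem integrates over Y first.  This is conditioning on Z. *)
Lemma integral_indep2_le d1 d2 (U : measurableType d1) (V : measurableType d2)
    (Y : T -> U) (Z : T -> V) (h : U * V -> R) (C : R) :
  measurable_fun setT Y -> measurable_fun setT Z -> indep2 P Y Z ->
  measurable_fun setT h -> (forall z, 0 <= h z) ->
  (forall v, (\int[P]_w (h (Y w, Z v))%:E <= C%:E)%E) ->
  (\int[P]_w (h (Y w, Z w))%:E <= C%:E)%E.
Proof.
move=> mY mZ indYZ mh h0 hC.
have mYZ : measurable_fun setT (fun w => (Y w, Z w)) by exact: measurable_fun_pair.
pose Y' : {mfun T >-> U} := HB.pack Y (isMeasurableFun.Build _ _ _ _ _ mY).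
pose Z' : {mfun T >-> V} := HB.pack Z (isMeasurableFun.Build _ _ _ _ _ mZ).
pose YZ : {mfun T >-> (U * V)%type} := HB.pack (fun w => (Y w, Z w)) (isMeasurableFun.Build _ _ _ _ _ mYZ).
pose m1 := distribution P Y'; pose m2 := distribution P Z'; pose m := distribution P YZ.
have mhE : measurable_fun setT (EFin \o h) by exact/measurable_EFinP.
have -> : (\int[P]_w (h (Y w, Z w))%:E = \int[m]_z (h z)%:E)%E.
  by rewrite (@ge0_integral_distribution _ _ _ _ _ P YZ (EFin \o h)).
have -> : (\int[m]_z (h z)%:E = \int[(m1 \x m2)%E]_z (h z)%:E)%E.
  apply: eq_measure_integral => A mA _; apply/esym.
  by apply: product_measure_unique => // B D mB mD; rewrite /= /m /distribution /pushforward /= -indYZ.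
have h0E z : (0 <= (h z)%:E)%E by rewrite lee_fin.
rewrite (fubini_tonelli2 (EFin \o h) mhE h0E).
have mG := @measurable_fun_fubini_tonelli_G _ _ _ _ _ m1 (EFin \o h) mhE h0E.
have G0 v : (0 <= fubini_G m1 (EFin \o h) v)%E by apply: integral_ge0 => x _; exact: h0E.
rewrite (@ge0_integral_distribution _ _ _ _ _ P Z' (fubini_G m1 (EFin \o h))) //.
apply: (@le_trans _ _ (\int[P]_w (cst C%:E w))%E); last first.
  rewrite integral_cst //= -[leRHS]mule1 le_eqVlt; apply/orP; left; apply/eqP.
  by congr (_ * _)%E; exact: probability_setT.
apply: ge0_le_integral => //.
- by move=> w _; exact: G0.
- exact: measurableT_comp.
- move=> v _; rewrite /= /fubini_G.
  rewrite (@ge0_integral_distribution _ _ _ _ _ P Y' (fun y => (h (y, Z v))%:E)); [exact: hC | | by move=> y; exact: h0E].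
  apply/measurable_EFinP; apply: (@measurableT_comp _ _ _ _ _ _ h) => //.
Qed.
End Indep.

(** * Sub-Gaussian moments and Chernoff bounds *)

Section Tails.
Context d (T : measurableType d) (R : realType) (P : probability T R).

(** Markov's inequality in the form used below: any g that dominates the
    indicator of A will do. *)
Lemma markov_indicator (A : set T) (g : T -> R) :
  measurable A -> measurable_fun setT g -> (forall w, 0 <= g w) ->
  (forall w, A w -> 1 <= g w) -> (P A <= \int[P]_w (g w)%:E)%E.
Proof.
move=> mA mg g0 g1; rewrite -[X in P X]setIT -integral_indic //.
apply: ge0_le_integral => //.
- by apply/measurable_EFinP; exact: measurable_indic.
- by apply/measurable_EFinP.
- move=> w _; rewrite lee_fin indicE; case: (boolP (w \in A)) => [/set_mem|_]; first exact: g1.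
  exact: g0.
Qed.

Lemma subgaussian_mgf s (Z : T -> R) t : subgaussian P s Z ->
  (\int[P]_w (expR (t * Z w))%:E <= (expR (s ^+ 2 * t ^+ 2 / 2))%:E)%E.
Proof.
move=> [_ /(_ t)]; rewrite /mmt_gen_fun unlock; apply: le_trans.
by rewrite le_eqVlt; apply/orP; left; apply/eqP; apply: eq_integral => w _ /=; rewrite mulrC.
Qed.

(** The bound of subgaussian_exp_square, the sum of the geometric series with
    first term 2 e^(1/4) and ratio e^(-1/4). *)
Definition exp_square_const : R := 2 * expR 4^-1 / (1 - expR (- 4^-1)).

Lemma expRN4_lt1 : expR (- 4^-1) < 1 :> R.
Proof. by rewrite expR_lt1 oppr_lt0. Qed.

Lemma exp_square_const_gt0 : 0 < exp_square_const.
Proof.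
have := expRN4_lt1 => H.
by rewrite /exp_square_const divr_gt0 ?mulr_gt0 ?expR_gt0 // subr_gt0.
Qed.

(** Cover the line by the shells m s <= |z| < (m + 1) s.  On the m-th shell
    exp (z^2 / (8 s^2)) is at most exp ((m + 1)^2 / 8 - m^2) times
    exp (m |z| / s), and the expectation of the latter is at most
    2 exp (m^2 / 2).  Since (m + 1)^2 / 8 - m^2 / 2 <= 1/4 - m / 4, the sum over
    the shells is a geometric series. *)
Lemma subgaussian_exp_square s (Z : T -> R) : 0 < s -> measurable_fun setT Z ->
  subgaussian P s Z ->
  (\int[P]_w (expR ((8 * s ^+ 2)^-1 * Z w ^+ 2))%:E <= exp_square_const%:E)%E.
Proof.
move=> s0 mZ sZ.
pose b (m : nat) : R := expR (m.+1%:R ^+ 2 / 8 - m%:R ^+ 2).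
pose f m w : R := b m * (expR (m%:R / s * Z w) + expR (- (m%:R / s) * Z w)).
have f0 m w : 0 <= f m w by rewrite mulr_ge0 ?addr_ge0 ?expR_ge0.
have mE t : measurable_fun setT (fun w => expR (t * Z w)).
  by apply: measurableT_comp => //; exact: measurable_funM.
have mf m : measurable_fun setT (f m).
  by apply: measurable_funM => //; exact: measurable_funD.
have pt w : ((expR ((8 * s ^+ 2)^-1 * Z w ^+ 2))%:E <= \sum_(m <oo) (f m w)%:E)%E.
  (* The shell that contains Z w; its term alone dominates. *)
  pose m := Num.truncn (`|Z w| / s).
  have /andP[m1 m2] : m%:R <= `|Z w| / s < m.+1%:R by apply: truncn_itv; rewrite divr_ge0 // ltW.
  apply: (@le_trans _ _ (f m w)%:E); last first.
    apply: le_trans (nneseries_lim_ge m.+1 _) => //.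
      by rewrite big_nat_recr //=; apply: leeDr; apply: sume_ge0 => i _; rewrite lee_fin.
    by move=> i _; rewrite lee_fin.
  rewrite lee_fin.
  have : expR (m%:R / s * `|Z w|) <= expR (m%:R / s * Z w) + expR (- (m%:R / s) * Z w).
    case: (ger0P (Z w)) => _; rewrite ?mulrN -?mulNr.
      by rewrite lerDl expR_ge0.
    by rewrite lerDr expR_ge0.
  move=> /(ler_wpM2l (expR_ge0 (m.+1%:R ^+ 2 / 8 - m%:R ^+ 2))); apply: le_trans.
  rewrite -expRD ler_expR.
  have -> : (8 * s ^+ 2)^-1 * Z w ^+ 2 = (`|Z w| / s) ^+ 2 / 8.
    by rewrite expr_div_n real_normK ?num_real // invfM mulrC mulrA mulrAC.
  have -> : m%:R / s * `|Z w| = m%:R * (`|Z w| / s) by rewrite mulrAC mulrA.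
  set z := `|Z w| / s in m1 m2 *.
  have H1 : m%:R * m%:R <= m%:R * z by apply: ler_wpM2l.
  have H2 : z ^+ 2 <= m.+1%:R ^+ 2.
    by rewrite ler_pXn2r // ?nnegrE ?(le_trans _ m1) // ltW.
  rewrite expr2 in H1 *; lra.
apply: (@le_trans _ _ (\int[P]_w (\sum_(m <oo) (f m w)%:E))%E).
  apply: ge0_le_integral => //.
  - apply/measurable_EFinP; apply: measurableT_comp => //.
    by apply: measurable_funM => //; exact: measurable_funX.
  - apply: ge0_emeasurable_sum => [m w _ _|m _]; first by rewrite lee_fin.
    by apply/measurable_EFinP.
rewrite integral_nneseries //; last 2 first.
- by move=> m; apply/measurable_EFinP.
- by move=> m w _; rewrite lee_fin.
apply: lime_le.
  by apply: is_cvg_nneseries => m _ _; apply: integral_ge0 => w _; rewrite lee_fin.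
apply: nearW => n.
have term m : (\int[P]_w (f m w)%:E <= (2 * expR 4^-1 * expR (- 4^-1) ^+ m)%:E)%E.
  rewrite /f; under eq_integral do rewrite EFinM EFinD.
  rewrite ge0_integralZl_EFin ?expR_ge0 //; last 2 first.
  - by move=> w _; rewrite -EFinD lee_fin addr_ge0 ?expR_ge0.
  - by apply: emeasurable_funD; apply/measurable_EFinP.
  rewrite ge0_integralD //; last 2 first.
  - by apply/measurable_EFinP.
  - by apply/measurable_EFinP.
  apply: (@le_trans _ _ ((b m)%:E * (expR (m%:R ^+ 2 / 2) + expR (m%:R ^+ 2 / 2))%:E)%E).
    apply: lee_wpmul2l; first by rewrite lee_fin expR_ge0.
    have E : s ^+ 2 * (m%:R / s) ^+ 2 / 2 = m%:R ^+ 2 / 2.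
      by rewrite expr_div_n mulrCA mulfV ?mulr1 // expf_neq0 // gt_eqF.
    rewrite EFinD; apply: leeD.
      by apply: le_trans (subgaussian_mgf _ sZ) _; rewrite E.
    by apply: le_trans (subgaussian_mgf _ sZ) _; rewrite sqrrN E.
  rewrite -EFinM lee_fin -mulrA.
  have -> : b m * (expR (m%:R ^+ 2 / 2) + expR (m%:R ^+ 2 / 2)) = 2 * (b m * expR (m%:R ^+ 2 / 2)) by ring.
  rewrite ler_wpM2l //.
  rewrite -expRD -expRM_natl -expRD ler_expR -natr1.
  case: m => [|m]; first by rewrite !mul0r expr0n /=; lra.
  have : 1 <= m.+1%:R :> R by rewrite ler1n.
  set x := m.+1%:R => x1; have : 0 <= (x - 1) ^+ 2 := sqr_ge0 _; nra.
apply: (@le_trans _ _ (\sum_(0 <= m < n) (2 * expR 4^-1 * expR (- 4^-1) ^+ m)%:E)%E).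
  by apply: lee_sum => m _; exact: term.
rewrite sumEFin lee_fin -mulr_sumr /exp_square_const ler_wpM2l ?mulr_ge0 ?expR_ge0 //.
have q1 : 0 < 1 - expR (- 4^-1) :> R by rewrite subr_gt0 expRN4_lt1.
rewrite -(ler_pM2r q1) mulVf ?gt_eqF // big_mkord mulrC.
have := subrX1 (expR (- 4^-1) : R) n.
have := exprn_ge0 n (expR_ge0 (- 4^-1) : 0 <= _ :> R).
set S := \sum_(i < n) _; set q := expR _; lra.
Qed.

Lemma sqr_le_expR (x : R) : 0 <= x -> x ^+ 2 <= 4 * expR x.
Proof.
move=> x0; have -> : expR x = expR (x / 2) ^+ 2 by rewrite -expRM_natl; congr expR; field.
have := expR_ge1Dx (x / 2) => H.
have H2 : (1 + x / 2) ^+ 2 <= expR (x / 2) ^+ 2 by rewrite ler_pXn2r // ?nnegrE ?expR_ge0 //; lra.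
nra.
Qed.

Lemma subgaussian_fourth_moment s (Z : T -> R) : 0 < s -> measurable_fun setT Z ->
  subgaussian P s Z ->
  (\int[P]_w ((Z w ^+ 2) ^+ 2)%:E <= (4 * exp_square_const * (8 * s ^+ 2) ^+ 2)%:E)%E.
Proof.
move=> s0 mZ sZ; have sp : 0 < 8 * s ^+ 2 by rewrite mulr_gt0 ?exprn_gt0.
have mE : measurable_fun setT (fun w => expR ((8 * s ^+ 2)^-1 * Z w ^+ 2)).
  by apply: measurableT_comp => //; apply: measurable_funM => //; exact: measurable_funX.
apply: (@le_trans _ _ (\int[P]_w ((4 * (8 * s ^+ 2) ^+ 2)%:E * (expR ((8 * s ^+ 2)^-1 * Z w ^+ 2))%:E))%E).
  apply: ge0_le_integral => //.
  - by move=> w _; rewrite lee_fin sqr_ge0.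
  - by apply/measurable_EFinP; do 2 apply: measurable_funX.
  - by apply: measurable_funeM; exact/measurable_EFinP.
  - move=> w _; rewrite -EFinM lee_fin mulrAC.
    rewrite -ler_pdivrMr ?exprn_gt0 // -expr_div_n mulrC.
    by apply: sqr_le_expR; rewrite mulr_ge0 ?sqr_ge0 // invr_ge0 ltW.
rewrite ge0_integralZl_EFin //; last 2 first.
- exact/measurable_EFinP.
- by rewrite mulr_ge0 // exprn_ge0 // ltW.
rewrite [leRHS](_ : _ = (4 * (8 * s ^+ 2) ^+ 2)%:E * exp_square_const%:E)%E; last first.
  by rewrite -EFinM; congr EFin; ring.
apply: lee_wpmul2l; last exact: subgaussian_exp_square.
by rewrite lee_fin mulr_ge0 // exprn_ge0 // ltW.
Qed.

Lemma lee_prod (I : finType) (f g : I -> \bar R) :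
  (forall i, 0 <= f i <= g i)%E -> (\prod_i f i <= \prod_i g i)%E.
Proof.
move=> fg.
suff /andP[] : (0 <= \prod_i f i <= \prod_i g i)%E by [].
elim/big_ind2 : _ => [|x y z t /andP[x0 xy] /andP[z0 zt]|i _]; last exact: fg.
- by rewrite lee_fin ler01 lexx.
- by rewrite mule_ge0 //= lee_pmul.
Qed.

(** Markov's inequality for the exponential of the sum; the usual parameter of
    the exponential is part of f. *)
Lemma chernoff_indep d' (U : measurableType d') N (Y : 'I_N -> T -> U) (f : U -> R) (b B : R) :
  (forall i, measurable_fun setT (Y i)) -> mutual_indep P Y -> measurable_fun setT f ->
  0 <= B ->
  (forall i, (\int[P]_w (expR (f (Y i w)))%:E <= B%:E)%E) ->
  (P [set w | (b < \sum_i f (Y i w))%R] <= (expR (- b) * B ^+ N)%:E)%E.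
Proof.
move=> mY indY mf B0 HB.
have mfY i : measurable_fun setT (fun w => f (Y i w)) by apply: (@measurableT_comp _ _ _ _ _ _ f).
have mS : measurable_fun setT (fun w => \sum_i f (Y i w)) by exact: measurable_sum.
apply: le_trans (@markov_indicator _ (fun w => expR (- b) * \prod_i expR (f (Y i w))) _ _ _ _) _.
- rewrite -[X in measurable X]setTI.
  rewrite [X in _ `&` X](_ : _ = (fun w => \sum_i f (Y i w)) @^-1` `]b, +oo[); first exact: mS.
  by apply/seteqP; split => w /=; rewrite in_itv /= andbT.
- apply: measurable_funM => //; apply: measurable_prod => i _.
  exact: measurableT_comp.
- by move=> w; rewrite mulr_ge0 ?expR_ge0 // prodr_ge0 // => i _; exact: expR_ge0.
- move=> w /= bw; rewrite -expR_sum -expRD -[leLHS]expR0 ler_expR; lra.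
under eq_integral do rewrite EFinM.
rewrite ge0_integralZl_EFin ?expR_ge0 //; last 2 first.
- by move=> w _; rewrite lee_fin prodr_ge0 // => i _; exact: expR_ge0.
- by apply/measurable_EFinP; apply: measurable_prod => i _; exact: measurableT_comp.
rewrite EFinM; apply: lee_wpmul2l; first by rewrite lee_fin expR_ge0.
apply: le_trans (@expectation_prod_indep_le _ _ _ P _ U N Y (fun _ u => expR (f u)) mY indY _ _) _.
- by move=> i; exact: measurableT_comp.
- by move=> i u; exact: expR_ge0.
have -> : (B ^+ N)%:E = (\prod_(i < N) B%:E)%E.
  by rewrite prodEFin prodr_const card_ord.
apply: lee_prod => i.
by rewrite HB andbT integral_ge0 // => w _; rewrite lee_fin expR_ge0.
Qed.

Lemma expRN_le (x : R) : 0 <= x -> expR (- x) <= 1 - x + x ^+ 2.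
Proof.
move=> x0; rewrite expRN invf_ple ?posrE ?expR_gt0 //; last by nra.
apply: le_trans (expR_ge1Dx x).
have p : 0 < 1 - x + x ^+ 2 by nra.
rewrite -(ler_pM2r p) mulVf ?gt_eqF //.
have := mulr_ge0 x0 (sqr_ge0 x); rewrite expr2; nra.
Qed.

(** A lower tail of a sum of nonnegative variables needs no exponential moment:
    exp (- t f) <= 1 - t f + t^2 f^2, so the Laplace transform of each term is
    controlled by a lower bound a of the mean and an upper bound K of the second
    moment. *)
Lemma lower_tail_indep d' (U : measurableType d') N (Y : 'I_N -> T -> U) (f : U -> R) (a K : R) :
  (forall i, measurable_fun setT (Y i)) -> mutual_indep P Y -> measurable_fun setT f ->
  (forall u, 0 <= f u) -> 0 < a -> 0 < K ->
  (forall i, (a%:E <= \int[P]_w (f (Y i w))%:E)%E) ->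
  (forall i, (\int[P]_w (f (Y i w) ^+ 2)%:E <= K%:E)%E) ->
  (P [set w | (\sum_i f (Y i w) < N%:R * (a / 2))%R] <= (expR (- (N%:R * (a ^+ 2 / (16 * K)))))%:E)%E.
Proof.
move=> mY indY mf f0 a0 K0 Ha HK.
(* This t makes t a / 2 - t^2 K equal to a^2 / (16 K). *)
pose t := a / (4 * K); have t0 : 0 < t by rewrite divr_gt0 // mulr_gt0.
have mfY i : measurable_fun setT (fun w => f (Y i w)) by apply: (@measurableT_comp _ _ _ _ _ _ f).
have mfE i : measurable_fun setT (fun w => expR (- t * f (Y i w))).
  by apply: measurableT_comp => //; exact: measurable_funM.
have one i : (\int[P]_w (expR (- t * f (Y i w)))%:E <= (expR (- (t * a) + t ^+ 2 * K))%:E)%E.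
  have H : (\int[P]_w (expR (- t * f (Y i w)))%:E + t%:E * \int[P]_w (f (Y i w))%:E
     <= 1 + (t ^+ 2)%:E * \int[P]_w (f (Y i w) ^+ 2)%:E)%E.
    rewrite -ge0_integralZl_EFin ?(ltW t0) //; last 2 first.
    - by move=> w _; rewrite lee_fin.
    - exact/measurable_EFinP.
    rewrite -ge0_integralZl_EFin ?sqr_ge0 //; last 2 first.
    - by move=> w _; rewrite lee_fin sqr_ge0.
    - by apply/measurable_EFinP; exact: measurable_funX.
    have -> : (1 = \int[P]_w (cst 1) w)%E by rewrite integral_cst // mul1e; apply/esym/probability_setT.
    rewrite -ge0_integralD //; last 3 first.
    - exact/measurable_EFinP.
    - by move=> w _; rewrite lee_fin mulr_ge0 // ltW.
    - by apply: measurable_funeM; exact/measurable_EFinP.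
    rewrite -ge0_integralD //; last 2 first.
    - by move=> w _; rewrite lee_fin mulr_ge0 // sqr_ge0.
    - by apply: measurable_funeM; apply/measurable_EFinP; exact: measurable_funX.
    apply: ge0_le_integral => //.
    - by move=> w _; rewrite -EFinM -EFinD lee_fin addr_ge0 ?expR_ge0 // mulr_ge0 // ltW.
    - apply: emeasurable_funD; first exact/measurable_EFinP.
      by apply: measurable_funeM; exact/measurable_EFinP.
    - apply: emeasurable_funD => //.
      by apply: measurable_funeM; apply/measurable_EFinP; exact: measurable_funX.
    - move=> w _; rewrite /= -!EFinM -!EFinD lee_fin mulNr.
      have := expRN_le (mulr_ge0 (ltW t0) (f0 (Y i w))); rewrite exprMn; lra.
  have : (\int[P]_w (expR (- t * f (Y i w)))%:E + (t * a)%:E <= (1 + t ^+ 2 * K)%:E)%E.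
    apply: le_trans (le_trans H _).
      by apply: leeD => //; rewrite EFinM; apply: lee_wpmul2l; [rewrite lee_fin ltW | exact: Ha].
    rewrite EFinD; apply: leeD => //; rewrite [leRHS]EFinM; apply: lee_wpmul2l => //.
    by rewrite lee_fin sqr_ge0.
  rewrite -leeBrDr // => H2; apply: le_trans H2 _; rewrite -EFinB lee_fin.
  apply: le_trans (expR_ge1Dx _); lra.
apply: le_trans (_ : P [set w | (- (t * (N%:R * (a / 2))) < \sum_i (- t * f (Y i w)))%R] <= _)%E.
  rewrite le_eqVlt; apply/orP; left; apply/eqP; congr (P _); apply/seteqP.
  by split => w /=; rewrite -mulr_sumr mulNr ltrN2 ltr_pM2l.
apply: le_trans (@chernoff_indep _ U N Y (fun u => - t * f u) _ _ mY indY _ (expR_ge0 _) one) _.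
  exact: measurable_funM.
rewrite opprK -expRM_natl -expRD lee_fin ler_expR le_eqVlt; apply/orP; left; apply/eqP.
by rewrite /t; field; rewrite gt_eqF.
Qed.

End Tails.

(** * The design and the noise *)

Section Design.
Context d (T : measurableType d) (R : realType) (P : probability T R).

Lemma subgaussian_square_integrable (s : R) (Z : T -> R) : 0 < s -> measurable_fun setT Z ->
  subgaussian P s Z -> P.-integrable setT (fun w => (Z w ^+ 2)%:E).
Proof.
move=> s0 mZ sZ.
have mZ2 : measurable_fun setT (fun w => Z w ^+ 2) by exact: measurable_funX.
apply/integrableP; split; first exact/measurable_EFinP.
apply: (@le_lt_trans _ _ (\int[P]_w (1 + ((Z w ^+ 2) ^+ 2)%:E))%E).
  apply: ge0_le_integral => //.
  - by apply: measurableT_comp => //; exact/measurable_EFinP.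
  - by apply: emeasurable_funD => //; apply/measurable_EFinP; exact: measurable_funX.
  - move=> w _; rewrite /= -EFinD lee_fin ger0_norm ?sqr_ge0 //.
    have := sqr_ge0 (Z w ^+ 2 - 1); have := sqr_ge0 (Z w); nra.
rewrite ge0_integralD //; last 2 first.
- by move=> w _; rewrite lee_fin sqr_ge0.
- by apply/measurable_EFinP; exact: measurable_funX.
rewrite [X in (X + _ < _)%E](_ : _ = 1%E); last first.
  by rewrite integral_cst // mul1e; exact: probability_setT.
apply: le_lt_trans (leeD (lexx _) (subgaussian_fourth_moment s0 mZ sZ)) _.
by rewrite -EFinD ltry.
Qed.

Lemma dot_row N n (X : 'M[R]_(N, n)) (u : 'cV[R]_n) r :
  (X *m u) r 0 = ((u)^T *m (row r X)^T) 0 0.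
Proof. by rewrite mxE dotmxE; apply: eq_bigr => i _; rewrite !mxE mulrC. Qed.

Lemma measurable_rows N n (X : T -> 'M[R]_(N, n)) :
  (forall r, measurable_fun setT (fun w => vtuple (row_of X r w))) ->
  forall r a, measurable_fun setT (fun w => X w r a).
Proof.
move=> mX r a; have /measurable_fun_tnthP/(_ a) := mX r.
rewrite (_ : _ \o _ = (fun w => X w r a : measurableTypeR R)) //.
by apply/funext => w /=; rewrite tnth_mktuple !mxE.
Qed.

Lemma measurable_mulmx N n (X : T -> 'M[R]_(N, n)) (u : T -> 'cV[R]_n) r :
  (forall r a, measurable_fun setT (fun w => X w r a)) ->
  (forall a, measurable_fun setT (fun w => u w a 0)) ->
  measurable_fun setT (fun w => (X w *m u w) r 0).
Proof.
move=> mX mu; under eq_fun do rewrite mxE.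
by apply: measurable_sum => a; exact: measurable_funM.
Qed.

Lemma measurable_sqnorm n (u : T -> 'cV[R]_n) :
  (forall a, measurable_fun setT (fun w => u w a 0)) ->
  measurable_fun setT (fun w => sqnorm (u w)).
Proof. by move=> mu; apply: measurable_sum => a; exact: measurable_funX. Qed.

Lemma measurable_l2norm n (u : T -> 'cV[R]_n) :
  (forall a, measurable_fun setT (fun w => u w a 0)) ->
  measurable_fun setT (fun w => l2norm (u w)).
Proof.
move=> mu; apply: (@measurableT_comp _ _ _ _ _ _ (@Num.sqrt R) _ (fun w => sqnorm (u w))).
  exact: (continuous_measurable_fun (@sqrt_continuous R)).
exact: measurable_sqnorm.
Qed.

Lemma l2norm_delta n (a : 'I_n) : l2norm (delta_mx a 0 : 'cV[R]_n) = 1.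
Proof.
rewrite /l2norm (bigD1 a) //= big1 => [|i /negPf ni].
  by rewrite mxE !eqxx expr1n addr0 sqrtr1.
by rewrite mxE ni expr0n.
Qed.

(** The rows are centered, so the covariances are the mixed second moments and
    the square expands bilinearly. *)
Lemma second_moment_quadratic N n s (Sigma : 'M[R]_n) (X : T -> 'M[R]_(N, n)) r (u : 'cV[R]_n) :
  0 < s -> rowwise_subgaussian P s Sigma X ->
  (\int[P]_w (((X w *m u) r 0) ^+ 2)%:E = (bform Sigma u u)%:E)%E.
Proof.
move=> s0 [[mX _ _] sX cX].
have mXe := measurable_rows mX.
have sq a : P.-integrable setT (fun w => (X w r a ^+ 2)%:E).
  apply: (@subgaussian_square_integrable s) => //.
  have [_ /(_ (delta_mx a 0) (l2norm_delta a))] := sX r.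
  congr (subgaussian _ _ _); apply/funext => w.
  by rewrite trmx_delta -rowE !mxE.
have iab a b : P.-integrable setT (fun w => (X w r a * X w r b)%:E).
  apply: (@le_integrable _ _ _ _ _ _ _ (fun w => ((X w r a ^+ 2)%:E + (X w r b ^+ 2)%:E)%E)) => //.
  - by apply/measurable_EFinP; exact: measurable_funM.
  - move=> w _; rewrite -EFinD /= lee_fin [leRHS]ger0_norm ?addr_ge0 ?sqr_ge0 //.
    rewrite ler_norml; have := sqr_ge0 (X w r a - X w r b).
    have := sqr_ge0 (X w r a + X w r b); have := sqr_ge0 (X w r a); have := sqr_ge0 (X w r b).
    by move=> *; apply/andP; split; nra.
  - exact: integrableD.
have Eab a b : (\int[P]_w (X w r a * X w r b)%:E = (Sigma a b)%:E)%E.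
  rewrite -(cX r a b) unlock.
  have E0 c : ('E_P[(fun w => X w r c)] = 0)%E.
    have [/(_ c) H _] := sX r; rewrite -[RHS]H; congr ('E_P[_])%E.
    by apply/funext => w; rewrite !mxE.
  rewrite !E0 unlock /=; apply: eq_integral => w _; congr EFin.
  by rewrite !mulrfctE /= /cst /= !oppr0 !addr0.
transitivity (\int[P]_w (\sum_(a < n) \sum_(b < n) (u a 0 * u b 0)%:E * (X w r a * X w r b)%:E))%E.
  apply: eq_integral => w _.
  transitivity ((\sum_(a < n) \sum_(b < n) u a 0 * u b 0 * (X w r a * X w r b))%:E).
    congr EFin; rewrite mxE expr2 mulr_suml; apply: eq_bigr => a _.
    by rewrite mulr_sumr; apply: eq_bigr => b _; ring.
  by rewrite -sumEFin; apply: eq_bigr => a _; rewrite -sumEFin; apply: eq_bigr => b _; rewrite EFinM.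
rewrite integral_sum //; last first.
  by move=> a; apply: integrable_sum => // b _; exact: integrableZl.
rewrite [RHS](_ : _ = \sum_(a < n) \sum_(b < n) (u a 0 * u b 0)%:E * (Sigma a b)%:E)%E.
  apply: eq_bigr => a _; rewrite integral_sum //; last by move=> b; exact: integrableZl.
  by apply: eq_bigr => b _; rewrite integralZl // Eab.
transitivity ((\sum_(a < n) \sum_(b < n) u a 0 * u b 0 * Sigma a b)%:E).
  congr EFin; rewrite bformE dotmxE; apply: eq_bigr => a _.
  by rewrite mxE mulr_sumr; apply: eq_bigr => b _; ring.
by rewrite -sumEFin; apply: eq_bigr => a _; rewrite -sumEFin; apply: eq_bigr => b _; rewrite EFinM.
Qed.

(** A bound for the squared norm of a column of the design divided by N that
    fails with probability at most exp (- N).  The summand 1 beyond the logarithm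
    of the exponential moment, which is at most exp_square_const, is what leaves
    the factor exp (- N). *)
Definition column_const (s : R) : R := 8 * s ^+ 2 * (1 + exp_square_const R).
(** A bound for the fourth moment of an s-sub-Gaussian variable, from
    subgaussian_fourth_moment. *)
Definition fourth_const (s : R) : R := 4 * exp_square_const R * (8 * s ^+ 2) ^+ 2.

Lemma column_tail N n s (Sigma : 'M[R]_n) (X : T -> 'M[R]_(N, n)) (j : 'I_n) :
  0 < s -> rowwise_subgaussian P s Sigma X ->
  (P [set w | (column_const s * N%:R < \sum_i X w i j ^+ 2)%R] <= (expR (- N%:R))%:E)%E.
Proof.
move=> s0 [[mX indX _] sX cX]; have mXe := measurable_rows mX.
have sp : 0 < 8 * s ^+ 2 by rewrite mulr_gt0 ?exprn_gt0.
pose f (x : n.-tuple (measurableTypeR R)) : R := (8 * s ^+ 2)^-1 * (tnth x j : R) ^+ 2.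
have mf : measurable_fun setT f.
  apply: measurable_funM => //; apply: (@measurable_funX _ _ _ _ (fun x => tnth x j : R)).
  exact: measurable_tnth.
have fE i w : f (vtuple (row_of X i w)) = (8 * s ^+ 2)^-1 * X w i j ^+ 2.
  by rewrite /f tnth_mktuple !mxE.
have HB i : (\int[P]_w (expR (f (vtuple (row_of X i w))))%:E <= (exp_square_const R)%:E)%E.
  under eq_integral do rewrite fE.
  apply: subgaussian_exp_square => //.
  have [_ /(_ (delta_mx j 0) (l2norm_delta j))] := sX i.
  congr (subgaussian _ _ _); apply/funext => w.
  by rewrite trmx_delta -rowE !mxE.
have K0 := exp_square_const_gt0 R.
have := chernoff_indep ((1 + exp_square_const R) * N%:R) mX indX mf (ltW K0) HB.
rewrite [X in (P X <= _)%E -> _](_ : _ = [set w | (column_const s * N%:R < \sum_i X w i j ^+ 2)%R]); last first.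
  have E w : \sum_i f (vtuple (row_of X i w)) = (8 * s ^+ 2)^-1 * \sum_i X w i j ^+ 2.
    by rewrite mulr_sumr; apply: eq_bigr => i _; exact: fE.
  apply/seteqP; split => w; rewrite /= E ltr_pdivlMl // /column_const !mulrA //.
move=> H; apply: le_trans H _; rewrite lee_fin.
have : exp_square_const R ^+ N <= expR (exp_square_const R) ^+ N.
  rewrite lerXn2r ?nnegrE ?expR_ge0 ?(ltW K0) //.
  by apply: le_trans (expR_ge1Dx _); rewrite lerDr.
move=> /(ler_wpM2l (expR_ge0 (- ((1 + exp_square_const R) * N%:R)))) H.
apply: le_trans H _; rewrite -expRM_natl -expRD ler_expR; lra.
Qed.

(** After scaling v to unit length, N^-1 |X v|^2 is a mean of independent squares
    with expectation at least c. *)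
Lemma sqnorm_lower_tail N n s c (Sigma : 'M[R]_n) (X : T -> 'M[R]_(N, n)) (v : 'cV[R]_n) :
  0 < s -> 0 < c -> (0 < N)%N -> rowwise_subgaussian P s Sigma X ->
  c * sqnorm v <= bform Sigma v v ->
  (P [set w | (N%:R^-1 * sqnorm (X w *m v) < c / 2 * sqnorm v)%R] <=
    (expR (- (N%:R * (c ^+ 2 / (16 * fourth_const s)))))%:E)%E.
Proof.
move=> s0 c0 N0 rX cv; have [[mX indX _] sX cX] := rX; have mXe := measurable_rows mX.
have [v0|v0] := eqVneq (sqnorm v) 0.
  rewrite (_ : [set w | _] = set0) ?measure0 ?lee_fin ?expR_ge0 //.
  apply/seteqP; split => w //=; rewrite v0 mulr0 ltNge.
  by apply/negP; rewrite negbK mulr_ge0 ?sqnorm_ge0 ?invr_ge0.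
have vp : 0 < sqnorm v by rewrite lt_def v0 sqnorm_ge0.
pose t := (Num.sqrt (sqnorm v))^-1; pose u := t *: v.
have t2 : t ^+ 2 = (sqnorm v)^-1 by rewrite exprVn sqr_sqrtr // sqnorm_ge0.
have u1 : l2norm u = 1 by rewrite /l2norm -/(sqnorm u) sqnormZ t2 mulVf // sqrtr1.
pose f (x : n.-tuple (measurableTypeR R)) : R := (\sum_a (tnth x a : R) * u a 0) ^+ 2.
have mf : measurable_fun setT f.
  apply: measurable_funX; apply: measurable_sum => a; apply: measurable_funM => //.
  exact: measurable_tnth.
have fE i w : f (vtuple (row_of X i w)) = ((X w *m u) i 0) ^+ 2.
  by rewrite /f mxE; congr (_ ^+ 2); apply: eq_bigr => a _; rewrite tnth_mktuple !mxE.
have K0 : 0 < fourth_const s.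
  by rewrite !mulr_gt0 ?exp_square_const_gt0 ?exprn_gt0 ?mulr_gt0 ?exprn_gt0.
have := @lower_tail_indep _ _ _ P _ _ N _ f c (fourth_const s) mX indX mf _ c0 K0 _ _.
rewrite [X in _ -> _ -> _ -> (P X <= _)%E](_ : _ =
    [set w | (N%:R^-1 * sqnorm (X w *m v) < c / 2 * sqnorm v)%R]); last first.
  have E w : \sum_i f (vtuple (row_of X i w)) = (sqnorm v)^-1 * sqnorm (X w *m v).
    by under eq_bigr do rewrite fE; rewrite -/(sqnorm (X w *m u)) /u -scalemxAr sqnormZ t2.
  have EE q : ((sqnorm v)^-1 * q < N%:R * (c / 2)) = (N%:R^-1 * q < c / 2 * sqnorm v).
    by rewrite [LHS]ltr_pdivrMl // [RHS]ltr_pdivrMl ?ltr0n //; congr (_ < _); ring.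
  by apply/seteqP; split => w; rewrite /= E EE.
apply => [x|i|i].
- exact: sqr_ge0.
- under eq_integral do rewrite fE; rewrite (second_moment_quadratic _ _ s0 rX) lee_fin.
  by rewrite /u bformZl bformZr mulrA -expr2 t2 ler_pdivlMl // mulrC.
- under eq_integral do rewrite fE.
  apply: subgaussian_fourth_moment => //.
    by apply: measurable_mulmx => // a; exact: measurable_cst.
  have [_ /(_ u u1)] := sX i; congr (subgaussian _ _ _); apply/funext => w.
  apply/esym; exact: dot_row.
Qed.

(** Given X, the j-th entry of X^T eps is sub-Gaussian with parameter s times the
    norm of the j-th column.  Restricting to the X whose column is bounded keeps
    this parameter below s sqrt (D N), which avoids any mixed moment of X and
    eps.  The sign (-1)^b gives both tails. *)
Lemma noise_tail_sided N n s D lam (X : T -> 'M[R]_(N, n)) (eps : T -> 'cV[R]_N) (j : 'I_n) (b : bool) :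
  0 < s -> 0 < D -> 0 < lam ->
  (forall r, measurable_fun setT (fun w => vtuple (row_of X r w))) ->
  iid P (fun i w => eps w i 0 : measurableTypeR R) ->
  (forall i, subgaussian P s (fun w => eps w i 0)) ->
  indep2 P (fun w => vtuple (eps w)) (fun w => mxtuple (X w)) ->
  (P [set w | (N%:R * lam < (-1) ^+ b * ((X w)^T *m eps w) j 0)%R /\
              (\sum_i X w i j ^+ 2 <= D * N%:R)%R] <=
   (expR (- (N%:R * (lam ^+ 2 / (2 * s ^+ 2 * D)))))%:E)%E.
Proof.
move=> s0 D0 l0 mX [me inde _] se indeX; have mXe := measurable_rows mX.
pose U : measurableType _ := N.-tuple (measurableTypeR R).
pose V : measurableType _ := N.-tuple (n.-tuple (measurableTypeR R)).
have mY : measurable_fun setT (fun w => vtuple (eps w) : U).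
  apply/measurable_fun_tnthP => i; rewrite (_ : _ \o _ = (fun w => eps w i 0 : measurableTypeR R)) //.
  by apply/funext => w /=; rewrite tnth_mktuple.
have mZ : measurable_fun setT (fun w => mxtuple (X w) : V).
  apply/measurable_fun_tnthP => i; rewrite (_ : _ \o _ = (fun w => vtuple (row_of X i w))) //.
  by apply/funext => w /=; rewrite tnth_mktuple.
(* The minimizer of s^2 t^2 D N / 2 - t N lam. *)
pose t := lam / (s ^+ 2 * D).
pose sq (x : V) : R := \sum_i (tnth (tnth x i) j : R) ^+ 2.
pose dot (z : U * V) : R := \sum_i (tnth z.1 i : R) * (tnth (tnth z.2 i) j : R).
pose S : set V := [set x | sq x <= D * N%:R].
pose h (z : U * V) : R := expR (t * (-1) ^+ b * dot z - t * (N%:R * lam)) * \1_S z.2.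
have mij i : measurable_fun setT (fun x : V => tnth (tnth x i) j : measurableTypeR R).
  apply: (@measurableT_comp _ _ _ _ _ _ (fun y : n.-tuple (measurableTypeR R) => tnth y j) _ (fun x : V => tnth x i)).
    exact: measurable_tnth.
  exact: measurable_tnth.
have msq : measurable_fun setT sq.
  by apply: measurable_sum => i; apply: measurable_funX; exact: mij.
have mS : measurable S.
  rewrite -[S]setTI (_ : S = sq @^-1` `]-oo, D * N%:R]); first exact: msq.
  by apply/seteqP; split => x; rewrite /S /= in_itv.
have mdot : measurable_fun setT dot.
  apply: measurable_sum => i; apply: measurable_funM.
    by apply: (@measurableT_comp _ _ _ _ _ _ (fun x : U => tnth x i)) => //; exact: measurable_tnth.
  by apply: (@measurableT_comp _ _ _ _ _ _ (fun x : V => tnth (tnth x i) j : measurableTypeR R)).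
have mh : measurable_fun setT h.
  apply: measurable_funM.
    apply: measurableT_comp => //; apply: measurable_funB => //.
    exact: measurable_funM.
  by apply: (@measurableT_comp _ _ _ _ _ _ (\1_S : V -> R)).
have h0 z : 0 <= h z by rewrite mulr_ge0 ?expR_ge0.
have dotE w w' : dot (vtuple (eps w), mxtuple (X w')) = \sum_i eps w i 0 * X w' i j.
  by apply: eq_bigr => i _; rewrite /= !tnth_mktuple !mxE.
have sqE w : sq (mxtuple (X w)) = \sum_i X w i j ^+ 2.
  by apply: eq_bigr => i _; rewrite /= !tnth_mktuple !mxE.
have t0 : 0 < t by rewrite divr_gt0 // mulr_gt0 // exprn_gt0.
apply: (@le_trans _ _ (\int[P]_w (h (vtuple (eps w), mxtuple (X w)))%:E)%E).
  apply: markov_indicator => //.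
  - rewrite [X in measurable X](_ : _ =
        (fun w => (-1) ^+ b * ((X w)^T *m eps w) j 0) @^-1` `]N%:R * lam, +oo[ `&`
        (fun w => \sum_i X w i j ^+ 2) @^-1` `]-oo, D * N%:R]); last first.
      by apply/seteqP; split => w /=; rewrite !in_itv /= andbT.
    apply: measurableI; rewrite -[X in measurable X]setTI.
    + have mX' : measurable_fun setT (fun w => (-1) ^+ b * ((X w)^T *m eps w) j 0).
        apply: measurable_funM => //; apply: measurable_mulmx => [r a|a]; last exact: me.
        by rewrite (_ : (fun w => _) = (fun w => X w a r)) //; apply/funext => w; rewrite mxE.
      exact: mX'.
    + have mX' : measurable_fun setT (fun w => \sum_i X w i j ^+ 2).
        by apply: measurable_sum => i; exact: measurable_funX.
      exact: mX'.
  - apply: (@measurableT_comp _ _ _ _ _ _ h) => //.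
    exact: measurable_fun_pair.
  - move=> w /= [H1 H2]; rewrite /h dotE /= indicE mem_set; last by rewrite /S /= sqE.
    rewrite mulr1 -[leLHS]expR0 ler_expR subr_ge0 -mulrA ler_pM2l //.
    apply: le_trans (ltW H1) _; rewrite le_eqVlt; apply/orP; left; apply/eqP.
    by rewrite mxE; congr (_ * _); apply: eq_bigr => i _; rewrite mxE mulrC.
apply: (integral_indep2_le mY mZ indeX mh h0) => w'.
have [HS|HS] := boolP (mxtuple (X w') \in S); last first.
  rewrite integral0_eq ?lee_fin ?expR_ge0 // => w _.
  by rewrite /h /= indicE (negPf HS) mulr0.
have Sle : \sum_i X w' i j ^+ 2 <= D * N%:R by rewrite -sqE; exact: (set_mem HS).
pose g (i : 'I_N) (e : measurableTypeR R) : R := expR (t * (-1) ^+ b * X w' i j * (e : R)).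
have mg i : measurable_fun setT (g i).
  by apply: measurableT_comp => //; apply: measurable_funM.
have mgE i : measurable_fun setT (fun w => g i (eps w i 0)).
  by apply: (@measurableT_comp _ _ _ _ _ _ (g i)) => //; exact: me.
rewrite (eq_integral (fun w => (expR (- (t * (N%:R * lam))))%:E * (\prod_i g i (eps w i 0))%:E)%E); last first.
  move=> w _; rewrite /h dotE /= indicE HS mulr1 -EFinM; congr EFin.
  rewrite /g -expR_sum -expRD; congr expR; rewrite addrC mulr_sumr; congr (_ + _).
  by apply: eq_bigr => i _; ring.
rewrite ge0_integralZl_EFin ?expR_ge0 //; last 2 first.
- by move=> w _; rewrite lee_fin prodr_ge0 // => i _; exact: expR_ge0.
- by apply/measurable_EFinP; exact: measurable_prod.
apply: (@le_trans _ _ ((expR (- (t * (N%:R * lam))))%:E * \prod_(i < N) (expR (s ^+ 2 * (t * X w' i j) ^+ 2 / 2))%:E)%E).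
  apply: lee_wpmul2l; first by rewrite lee_fin expR_ge0.
  apply: le_trans (@expectation_prod_indep_le _ _ _ P _ _ N _ g me inde mg _) _.
    by move=> i e; exact: expR_ge0.
  apply: lee_prod => i; apply/andP; split.
    by apply: integral_ge0 => w _; rewrite lee_fin expR_ge0.
  apply: le_trans (subgaussian_mgf _ (se i)) _.
  have -> : (t * (-1) ^+ b * X w' i j) ^+ 2 = (t * X w' i j) ^+ 2 by rewrite mulrAC exprMn sqrr_sign mulr1.
  by [].
rewrite prodEFin -EFinM -expR_sum -expRD lee_fin ler_expR.
have -> : \sum_(i < N) s ^+ 2 * (t * X w' i j) ^+ 2 / 2 = s ^+ 2 * t ^+ 2 / 2 * \sum_i X w' i j ^+ 2.
  by rewrite mulr_sumr; apply: eq_bigr => i _; rewrite exprMn; ring.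
have p : 0 <= s ^+ 2 * t ^+ 2 / 2 by rewrite divr_ge0 // mulr_ge0 // sqr_ge0.
have := ler_wpM2l p Sle.
suff -> : N%:R * (lam ^+ 2 / (2 * s ^+ 2 * D)) = t * (N%:R * lam) - s ^+ 2 * t ^+ 2 / 2 * (D * N%:R) by lra.
by rewrite /t; field; rewrite !gt_eqF.
Qed.
End Design.

(** * The event on which recovery succeeds *)

Section Events.
Context d (T : measurableType d) (R : realType) (P : probability T R).

Lemma union_bound_seq (I : eqType) (r : seq I) (B : I -> set T) (b : R) :
  (forall i, measurable (B i)) -> (forall i, (P (B i) <= b%:E)%E) ->
  exists E, [/\ measurable E, forall i, i \in r -> B i `<=` E &
    (P E <= ((size r)%:R * b)%:E)%E].
Proof.
move=> mB Pb; elim: r => [|i r [E [mE BE PE]]].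
  by exists set0; split => //; rewrite measure0 mul0r.
exists (B i `|` E); split; first exact: measurableU.
- move=> j; rewrite inE => /orP[/eqP -> w Bw|jr w Bw]; first by left.
  by right; exact: (BE j).
- apply: le_trans (measureU2 _ _ _) _ => //=.
  by rewrite -natr1 addrC mulrDl mul1r EFinD; exact: leeD.
Qed.

Lemma union_bound (I : finType) (B : I -> set T) (b : R) :
  (forall i, measurable (B i)) -> (forall i, (P (B i) <= b%:E)%E) ->
  exists E, [/\ measurable E, forall i, B i `<=` E & (P E <= (#|I|%:R * b)%:E)%E].
Proof.
move=> mB Pb; have [E [mE BE PE]] := union_bound_seq (enum I) mB Pb.
exists E; split => // [i|]; last by rewrite cardE.
by apply: BE; rewrite mem_enum.
Qed.

Lemma measurable_lt_preimage (f g : T -> R) :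
  measurable_fun setT f -> measurable_fun setT g -> measurable [set w | f w < g w].
Proof.
move=> mf mg; have mfg : measurable_fun setT (fun w => g w - f w) by exact: measurable_funB.
rewrite -[X in measurable X]setTI (_ : [set w | _] = (fun w => g w - f w) @^-1` `]0, +oo[).
  exact: mfg.
by apply/seteqP; split => w; rewrite /= in_itv /= andbT subr_gt0.
Qed.

Lemma measurable_le_preimage (f g : T -> R) :
  measurable_fun setT f -> measurable_fun setT g -> measurable [set w | f w <= g w].
Proof.
move=> mf mg; rewrite (_ : [set w | _] = ~` [set w | g w < f w]).
  by apply: measurableC; exact: measurable_lt_preimage.
by apply/seteqP; split => w /=; rewrite leNgt => /negP.
Qed.

Definition lower_rate (s c : R) : R := c ^+ 2 / (16 * fourth_const s).

(** Outside one event, the union of the three kinds of failure, everything random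
    that the deterministic analysis uses holds at once.  The summands are the union
    bounds over the (2 n)^(q+1) signed sums, the n columns, and the 2 n signed
    noise entries. *)
Lemma design_event N n q s se c lam (Sigma : 'M[R]_n) (X : T -> 'M[R]_(N, n)) (eps : T -> 'cV[R]_N) :
  0 < s -> 0 < se -> 0 < c -> 0 < lam -> (0 < N)%N -> 
  rowwise_subgaussian P s Sigma X ->
  (forall u, c * sqnorm u <= bform Sigma u u) ->
  iid P (fun i w => eps w i 0 : measurableTypeR R) ->
  (forall i, subgaussian P se (fun w => eps w i 0)) ->
  indep2 P (fun w => vtuple (eps w)) (fun w => mxtuple (X w)) ->
  exists E : set T, [/\ measurable E,
    (P E <= ((2 * n%:R) ^+ q.+1 * expR (- (N%:R * lower_rate s c))
       + n%:R * expR (- N%:R)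
       + 2 * n%:R * expR (- (N%:R * (lam ^+ 2 / (2 * se ^+ 2 * column_const s)))))%:E)%E &
    forall w, ~ E w ->
    [/\ forall j, `|((X w)^T *m eps w) j 0| <= N%:R * lam,
        forall j, \sum_i X w i j ^+ 2 <= column_const s * N%:R &
        forall r : q.+1.-tuple (bool * 'I_n),
          c / 2 * sqnorm (\sum_(b <- r) signed_basis b) <=
          N%:R^-1 * sqnorm (X w *m \sum_(b <- r) signed_basis b)]].
Proof.
move=> s0 se0 c0 l0 N0 rX Sc ie sube indeX.
have [[mX _ _] _ _] := rX; have mXe := measurable_rows mX.
have [me _ _] := ie.
have D0 : 0 < column_const s.
  by rewrite !mulr_gt0 ?exprn_gt0 ?addr_gt0 ?exp_square_const_gt0.
have mcol j : measurable_fun setT (fun w => \sum_i X w i j ^+ 2).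
  by apply: measurable_sum => i; exact: measurable_funX.
pose v (r : q.+1.-tuple (bool * 'I_n)) : 'cV[R]_n := \sum_(b <- r) signed_basis b.
have mR r : measurable [set w | (N%:R^-1 * sqnorm (X w *m v r) < c / 2 * sqnorm (v r))%R].
  apply: measurable_lt_preimage => //; apply: measurable_funM => //.
  apply: measurable_sqnorm => i; apply: measurable_mulmx => // a; exact: measurable_cst.
have [E1 [mE1 BE1 PE1]] := union_bound mR (fun r => sqnorm_lower_tail s0 c0 N0 rX (Sc (v r))).
have [E2 [mE2 BE2 PE2]] := @union_bound 'I_n _ _
  (fun j => measurable_lt_preimage (measurable_cst _) (mcol j))
  (fun j => @column_tail _ _ _ P _ _ _ _ _ j s0 rX).
have mN j (b : bool) : measurable [set w | (N%:R * lam < (-1) ^+ b * ((X w)^T *m eps w) j 0)%R /\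
              (\sum_i X w i j ^+ 2 <= column_const s * N%:R)%R].
  apply: measurableI.
    apply: measurable_lt_preimage => //; apply: measurable_funM => //.
    apply: measurable_mulmx => [r a|a]; last exact: me.
    by rewrite (_ : (fun w => _) = (fun w => X w a r)) //; apply/funext => w; rewrite mxE.
  exact: measurable_le_preimage.
have [E3 [mE3 BE3 PE3]] := @union_bound ('I_n * bool)%type _ _
  (fun jb => mN jb.1 jb.2)
  (fun jb => noise_tail_sided jb.1 jb.2 se0 D0 l0 mX ie sube indeX).
exists (E1 `|` E2 `|` E3); split; first by apply: measurableU => //; exact: measurableU.
- apply: le_trans (measureU2 _ _ _) _ => //; first exact: measurableU.
  rewrite EFinD; apply: leeD.
    apply: le_trans (measureU2 _ _ _) _ => //; rewrite EFinD; apply: leeD.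
      apply: le_trans PE1 _; rewrite lee_fin card_tuple card_prod card_bool card_ord.
      by rewrite natrX natrM.
    by apply: le_trans PE2 _; rewrite card_ord.
  by apply: le_trans PE3 _; rewrite card_prod card_ord card_bool natrM [n%:R * _]mulrC.
- move=> w nE.
  have n1 : ~ E1 w by move=> h; apply: nE; left; left.
  have n2 : ~ E2 w by move=> h; apply: nE; left; right.
  have n3 : ~ E3 w by move=> h; apply: nE; right.
  have H2 j : \sum_i X w i j ^+ 2 <= column_const s * N%:R.
    by rewrite leNgt; apply/negP => h; apply: n2; exact: (BE2 j).
  split => // [j|r]; last first.
    by rewrite leNgt; apply/negP => h; apply: n1; exact: (BE1 r).
  have sided (b : bool) : (-1) ^+ b * ((X w)^T *m eps w) j 0 <= N%:R * lam.
    rewrite leNgt; apply/negP => h; apply: n3; apply: (BE3 (j, b)); split => //=; exact: H2.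
  rewrite ler_norml; have := sided true; have := sided false.
  by rewrite expr0 expr1 mul1r mulN1r => -> /=; rewrite lerNl => ->.
Qed.
End Events.

(** * From the event to the rates *)

Section Final.
Context {R : realType}.

Lemma expRN_decay (C kap x e : R) : 0 < kap -> 0 <= C -> 0 < e ->
  C / (kap * e) <= x -> C * expR (- (x * kap)) <= e.
Proof.
move=> k0 C0 e0; rewrite ler_pdivrMr ?mulr_gt0 // => H.
rewrite expRN ler_pdivrMr ?expR_gt0 //.
have := expR_ge1Dx (x * kap) => /(ler_wpM2l (ltW e0)); lra.
Qed.

Lemma column_const_gt0 (s : R) : 0 < s -> 0 < column_const s.
Proof. by move=> s0; rewrite !mulr_gt0 ?exprn_gt0 ?addr_gt0 ?exp_square_const_gt0. Qed.

Lemma lower_rate_gt0 (s c : R) : 0 < s -> 0 < c -> 0 < lower_rate s c.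
Proof.
move=> s0 c0; rewrite divr_gt0 ?exprn_gt0 // mulr_gt0 //.
by rewrite !mulr_gt0 ?exp_square_const_gt0 ?exprn_gt0 ?mulr_gt0 ?exprn_gt0.
Qed.

Lemma natr_expR_ln (n : nat) : (0 < n)%N -> n%:R = expR (ln n%:R) :> R.
Proof. by move=> n0; rewrite lnK // posrE ltr0n. Qed.

(** With K0 s2 + 1 summands the number of signed sums is at most
    exp (4 K0 s2 log n), because 2 n <= n^2.  The sample size requirement makes
    this at most half of the exponent Nr kap. *)
Lemma sparse_union_cost_le (n s2 K0 : nat) (Nr kap : R) :
  (1 < n)%N -> (0 < s2)%N -> (0 < K0)%N -> 0 < kap ->
  8 * K0%:R / kap * s2%:R * ln n%:R <= Nr ->
  (2 * n%:R) ^+ (K0 * s2).+1 * expR (- (Nr * kap)) <= expR (- (Nr * (kap / 2))).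
Proof.
move=> n1 s20 K00 k0 H.
have L0 : 0 < ln n%:R :> R by rewrite ln_gt0 // ltr1n.
have H1 : 2 * n%:R <= expR (2 * ln n%:R) :> R.
  rewrite expRM_natl -natr_expR_ln 1?ltnW // expr2 ler_wpM2r //.
  by rewrite ler_nat.
have H2 : (2 * n%:R) ^+ (K0 * s2).+1 <= expR (4 * (K0%:R * s2%:R) * ln n%:R) :> R.
  apply: (@le_trans _ _ (expR (2 * ln n%:R) ^+ (K0 * s2).+1)).
    by rewrite lerXn2r ?nnegrE ?expR_ge0.
  rewrite -expRM_natl ler_expR mulrA ler_wpM2r ?(ltW L0) //.
  have : 1 <= K0%:R * s2%:R :> R by rewrite -natrM ler1n muln_gt0 K00.
  by rewrite -natr1 natrM; lra.
apply: (@le_trans _ _ (expR (4 * (K0%:R * s2%:R) * ln n%:R) * expR (- (Nr * kap)))).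
  by rewrite ler_wpM2r ?expR_ge0.
rewrite -expRD ler_expR.
have : 8 * K0%:R / kap * s2%:R * ln n%:R * kap <= Nr * kap by rewrite ler_wpM2r ?(ltW k0).
have -> : 8 * K0%:R / kap * s2%:R * ln n%:R * kap = 8 * (K0%:R * s2%:R * ln n%:R).
  by field; rewrite gt_eqF.
lra.
Qed.

(** The sum of the constants of the three bounds of gpp_rate at a = c / 4, so that
    one constant serves all of them. *)
Definition rate_const (c A B kap : R) : R :=
  let K := 2 * (B * kap + 2) in
  K / (c / 4) * A + kap * (K / (c / 4)) * A + K ^+ 2 / (c / 4) * A ^+ 2.

Lemma rate_const_ge0 (c A B kap : R) :
  0 < c -> 0 < A -> 0 <= B -> 0 <= kap -> 0 <= rate_const c A B kap.
Proof.
move=> c0 A0 B0 kap0; rewrite /rate_const; set K := 2 * _.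
have K0 : 0 <= K by rewrite /K; have := mulr_ge0 B0 kap0; lra.
have Ka0 : 0 <= K / (c / 4) by rewrite divr_ge0 // divr_ge0 // ltW.
have A0' := ltW A0.
apply: addr_ge0; first apply: addr_ge0.
- exact: mulr_ge0.
- by apply: mulr_ge0 => //; exact: mulr_ge0.
- apply: mulr_ge0; last exact: sqr_ge0.
  by apply: divr_ge0; [exact: sqr_ge0 | apply: divr_ge0 => //; exact: ltW].
Qed.

(** The three rates hold with constant M outside a measurable event of probability
    at most delta. *)
Definition recovery_whp d (T : measurableType d) (P : probability T R) (N n s2 : nat) (se : R)
    (X : T -> 'M[R]_(N, n)) (h : T -> 'cV[R]_n) (delta M : R) : Prop :=
  exists E : set T, [/\ measurable E, (P E <= delta%:E)%E &
    forall w, ~ E w ->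
    [/\ l2norm (h w) <= M * (se * Num.sqrt (s2%:R * ln n%:R / N%:R)),
        l1norm (h w) <= M * (se * s2%:R * Num.sqrt (ln n%:R / N%:R)) &
        N%:R^-1 * l2norm (X w *m h w) ^+ 2 <=
          M * (se ^+ 2 * (s2%:R * ln n%:R / N%:R))]].

Lemma recovery_whp_weaken d (T : measurableType d) (P : probability T R) (N n s2 : nat) (se : R)
    (X : T -> 'M[R]_(N, n)) (h : T -> 'cV[R]_n) (delta delta' M M' : R) :
  (0 < n)%N -> 0 <= se -> delta <= delta' -> M <= M' ->
  recovery_whp P s2 se X h delta M -> recovery_whp P s2 se X h delta' M'.
Proof.
move=> n0 se0 dd MM [E [mE PE HE]]; exists E; split => //.
  by apply: le_trans PE _; rewrite lee_fin.
have L0 : 0 <= ln n%:R :> R by rewrite ln_ge0 // ler1n.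
move=> w /HE[b1 b2 b3]; split.
- apply: le_trans b1 _; rewrite ler_wpM2r // mulr_ge0 ?sqrtr_ge0 //.
- by apply: le_trans b2 _; rewrite ler_wpM2r // !mulr_ge0 ?sqrtr_ge0.
- by apply: le_trans b3 _; rewrite ler_wpM2r // mulr_ge0 ?sqr_ge0 // divr_ge0 ?mulr_ge0.
Qed.

(** The two alternatives are the cone case (noise level 1/2 and q of order s2) and
    the low-dimensional case (any noise level, q of order n).  In both, q is large
    enough for the defect D |h|_1^2 / q of the restricted eigenvalue bound to use up
    only half of its c / 2. *)
Lemma gpp_recovery d (T : measurableType d) (P : probability T R)
  (N n s1 s2 k q : nat) (G : sgraph n) (nu s se c A B kap l : R)
  (Sigma : 'M[R]_n) (X : T -> 'M[R]_(N, n)) (eps : T -> 'cV[R]_N)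
  (bs : 'cV[R]_n) (bh : T -> 'cV[R]_n) :
  0 <= nu -> 0 < s -> 0 < se -> 0 < c -> 0 < A -> 0 < B -> 0 <= kap ->
  (0 < N)%N -> (1 < n)%N -> (0 < s1)%N -> (0 < s2)%N -> (0 < q)%N ->
  nu <= s2%:R / s1%:R -> param_space G k s1 s2 bs ->
  rowwise_subgaussian P s Sigma X ->
  (forall x, eigenvalue Sigma x -> c <= x) ->
  iid P (fun i w => eps w i 0 : measurableTypeR R) ->
  (forall i, subgaussian P se (fun w => eps w i 0)) ->
  indep2 P (fun w => vtuple (eps w)) (fun w => mxtuple (X w)) ->
  l = A * (se * Num.sqrt (ln n%:R / N%:R)) ->
  (forall w, gpp_lasso G k l (l * Num.sqrt (nu / (2 * (max_degree G)%:R) ^+ k.+1))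
     (X w) (X w *m bs + eps w) (bh w)) ->
  (B = 2^-1 /\ kap = 6 /\ column_const s * (36 * s2%:R) <= q%:R * (c / 4) \/
   n%:R <= kap ^+ 2 /\ column_const s * n%:R <= q%:R * (c / 4)) ->
  recovery_whp P s2 se X (fun w => bh w - bs)
    ((2 * n%:R) ^+ q.+1 * expR (- (N%:R * lower_rate s c))
       + n%:R * expR (- N%:R)
       + 2 * n%:R * expR (- (B ^+ 2 * A ^+ 2 / (2 * column_const s) * ln n%:R)))
    (rate_const c A B kap).
Proof.
move=> nu0 s0 se0 c0 A0 B0 kap0 N0 n1 s10 s20 q0 nus bS rX eigS ie sube indeX lE Hl Hcase.
set rho := Num.sqrt (ln n%:R / N%:R) in lE *.
have Nr0 : 0 < N%:R :> R by rewrite ltr0n.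
have L0 : 0 < ln n%:R :> R by rewrite ln_gt0 // ltr1n.
have LN0 : 0 < ln n%:R / N%:R :> R by rewrite divr_gt0.
have rho0 : 0 < rho by rewrite sqrtr_gt0.
have rho2 : rho ^+ 2 = ln n%:R / N%:R by rewrite sqr_sqrtr // ltW.
have l0 : 0 < l by rewrite lE !mulr_gt0.
have D0 := column_const_gt0 s0.
have Ssym : Sigma^T = Sigma.
  have [_ _ cX] := rX; apply/matrixP => i j; rewrite mxE.
  by apply: EFin_inj; rewrite -!(cX (Ordinal N0)) covarianceC.
have Sc := min_eigenvalue_le (ltnW n1) Ssym eigS.
have [E [mE PE HE]] := @design_event _ _ _ P N n q s se c (B * l) Sigma X eps
  s0 se0 c0 (mulr_gt0 B0 l0) N0 rX Sc ie sube indeX.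
exists E; split => //.
  apply: le_trans PE _; rewrite lee_fin lerD2l.
  rewrite le_eqVlt; apply/orP; left; apply/eqP; congr (_ * expR _); congr (- _).
  rewrite lE !exprMn rho2; field.
  by rewrite !gt_eqF.
move=> w /HE[H1 H2 H3].
set h := bh w - bs.
have a0 : 0 < c / 4 by rewrite divr_gt0.
have r1 : 1 <= Num.sqrt s2%:R :> R by rewrite -[leLHS]sqrtr1 ler_wsqrtr // ler1n.
have RE := restricted_eigenvalue h (ltW (divr_gt0 c0 (ltr0Sn R 1))) N0 H2 H3.
have h0 := l2norm_ge0 h.
have := @gpp_rate R N n G k s1 s2 nu l B kap (c / 4) (X w) (eps w) bs h N0 s10 nu0 l0 a0 (ltW B0) kap0 nus bS.
have -> : bs + h = bh w by rewrite /h addrC subrK.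
move=> /(_ (Hl w) H1) HR.
have {HR} [] := HR.
- case: Hcase => [[-> [-> _]]|[nk _]]; first by left.
  right; apply: le_trans (l1norm_le h) _.
  apply: (@le_trans _ _ (kap * l2norm h)).
    rewrite ler_wpM2r // -(ler_pXn2r (ltn0Sn 1)) ?nnegrE ?sqrtr_ge0 //.
    by rewrite sqr_sqrtr.
  by rewrite ler_wpM2l // ler_peMl.
- move=> Hcone.
  suff HD : column_const s * l1norm h ^+ 2 <= q%:R * (c / 4) * sqnorm h.
    have qr : 0 < q%:R :> R by rewrite ltr0n.
    rewrite -(ler_pM2l qr); move: RE HD.
    set a := sqnorm h; set b := sqnorm (X w *m h); set e := column_const s * _; lra.
  case: Hcase => [[_ [kE Hq]]|[_ Hq]].
    apply: le_trans (ler_wpM2r (sqnorm_ge0 h) Hq); rewrite -[leRHS]mulrA ler_wpM2l ?(ltW D0) //.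
    rewrite -sqr_l2norm.
    have -> : 36 * s2%:R * l2norm h ^+ 2 = (6 * (Num.sqrt s2%:R * l2norm h)) ^+ 2.
      by rewrite !exprMn (sqr_sqrtr (ler0n R s2)); ring.
    by rewrite lerXn2r ?nnegrE ?l1norm_ge0 -?kE // !mulr_ge0.
  apply: le_trans (ler_wpM2r (sqnorm_ge0 h) Hq); rewrite -[leRHS]mulrA ler_wpM2l ?(ltW D0) //.
  rewrite -sqr_l2norm.
  have -> : n%:R * l2norm h ^+ 2 = (Num.sqrt n%:R * l2norm h) ^+ 2.
    by rewrite exprMn (sqr_sqrtr (ler0n R n)).
  by rewrite lerXn2r ?nnegrE ?l1norm_ge0 ?mulr_ge0 // l1norm_le.
have K0 : 0 <= 2 * (B * kap + 2) by have := mulr_ge0 (ltW B0) kap0; lra.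
rewrite (sqr_sqrtr (ler0n R s2)) // -[s2%:R * ln n%:R / N%:R]mulrA sqrtrM // -/rho -rho2.
rewrite [l2norm (_ *m _) ^+ 2]sqr_l2norm /rate_const.
set K := 2 * _ in K0 *.
have Ka0 : 0 <= K / (c / 4) by rewrite divr_ge0 // ltW.
have t1 : 0 <= K / (c / 4) * A by rewrite mulr_ge0 // ltW.
have t2 : 0 <= kap * (K / (c / 4)) * A by rewrite -mulrA mulr_ge0.
have t3 : 0 <= K ^+ 2 / (c / 4) * A ^+ 2 by rewrite mulr_ge0 ?sqr_ge0 // divr_ge0 ?sqr_ge0 // ltW.
move=> B1 B2 B3; split.
- apply: le_trans B1 _.
  have -> : K / (c / 4) * (l * Num.sqrt s2%:R) = K / (c / 4) * A * (se * (Num.sqrt s2%:R * rho)).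
    by rewrite lE; ring.
  by rewrite ler_wpM2r ?mulr_ge0 ?sqrtr_ge0 ?(ltW se0) //; lra.
- apply: le_trans B2 _.
  have -> : kap * (K / (c / 4)) * (l * s2%:R) = kap * (K / (c / 4)) * A * (se * s2%:R * rho).
    by rewrite lE; ring.
  by rewrite ler_wpM2r ?mulr_ge0 ?sqrtr_ge0 ?(ltW se0) //; lra.
- apply: le_trans B3 _.
  have -> : K ^+ 2 / (c / 4) * (l * Num.sqrt s2%:R) ^+ 2 =
     K ^+ 2 / (c / 4) * A ^+ 2 * (se ^+ 2 * (s2%:R * rho ^+ 2)).
    by rewrite lE !exprMn (sqr_sqrtr (ler0n R s2)); ring.
  by rewrite ler_wpM2r ?mulr_ge0 ?sqr_ge0 //; lra.
Qed.

(** The exceptional sets E may depend on delta; measurability of Z is what lets the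
    probability of a large value be compared with that of E. *)
Lemma le_OP_of_events (disp : nat -> measure_display)
    (Om : forall m, measurableType (disp m)) (P : forall m, probability (Om m) R)
    (Z : forall m, Om m -> R) (a : nat -> R) :
  (forall m, measurable_fun setT (Z m)) -> (forall m w, 0 <= Z m w) ->
  (forall delta : R, 0 < delta -> exists M : R, \forall m \near \oo,
     0 < a m /\ exists E : set (Om m), [/\ measurable E, (P m E <= delta%:E)%E &
       forall w, ~ E w -> Z m w <= M * a m]) ->
  le_OP P Z a.
Proof.
move=> mZ Z0 H delta d0; have [M HM] := H delta d0; exists M.
apply: filterS HM => m [am0 [E [mE PE HE]]].
apply: le_trans PE; apply: le_measure; [ | exact: mem_set | ].
- apply/mem_set; apply: (@measurable_lt_preimage _ _ _ (fun=> M) (fun w => `|Z m w / a m|)) => //.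
  by apply: measurableT_comp => //; exact: measurable_funM.
- move=> w /= Mw; apply: contrapT => /HE; apply/negP; rewrite -ltNge.
  by move: Mw; rewrite ger0_norm ?divr_ge0 ?(ltW am0) // ltr_pdivlMr.
Qed.

End Final.

Theorem theorem2
  (R : realType) (k : nat) (nu sigma_eps sigma_x c c' : R)
  (hnu : 0 <= nu < 1) (hsigma_eps : 0 < sigma_eps) (hsigma_x : 0 < sigma_x)
  (hc : 0 < c) (hcc' : c <= c') :
  (* A is the constant in the choice of lambda, C0 the one in the sample size
     requirement; neither depends on the sequence of problems. *)
  exists A C0 : R, 0 < A /\ 0 < C0 /\
  forall (N n s1 s2 : nat -> nat)
    (G : forall m, sgraph (n m))
    (disp : nat -> measure_display)
    (Om : forall m, measurableType (disp m))
    (P : forall m, probability (Om m) R)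
    (Sigma : forall m, 'M[R]_(n m))
    (X : forall m, Om m -> 'M[R]_(N m, n m))
    (eps y : forall m, Om m -> 'cV[R]_(N m))
    (betastar : forall m, 'cV[R]_(n m))
    (betahat : forall m, Om m -> 'cV[R]_(n m))
    (lambda lambda_g : nat -> R),
  N m @[m --> \oo] --> \oo ->
  (\forall m \near \oo, C0 * (s2 m)%:R * ln (n m)%:R <= (N m)%:R) ->
  (forall m, (1 < n m)%N) ->
  (forall m, (0 < s1 m)%N) ->
  (forall m, (0 < s2 m)%N) ->
  (forall m, nu <= (s2 m)%:R / (s1 m)%:R) ->
  (forall m, param_space (G m) k (s1 m) (s2 m) (betastar m)) ->
  (forall m, rowwise_subgaussian (P m) sigma_x (Sigma m) (X m)) ->
  (forall m, eigenvalues_in (Sigma m) c c') ->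
  (forall m, iid (P m) (fun i w => eps m w i 0 : measurableTypeR R)) ->
  (forall m i, subgaussian (P m) sigma_eps (fun w => eps m w i 0)) ->
  (forall m, indep2 (P m) (fun w => vtuple (eps m w))
                          (fun w => mxtuple (X m w))) ->
  (forall m w, y m w = X m w *m betastar m + eps m w) ->
  (forall m, lambda m = A * (sigma_eps * Num.sqrt (ln (n m)%:R / (N m)%:R))) ->
  (forall m, lambda_g m =
     lambda m * Num.sqrt (nu / (2 * (max_degree (G m))%:R) ^+ k.+1)) ->
  (forall m, measurable_fun [set: Om m] (fun w => vtuple (betahat m w))) ->
  (forall m w, gpp_lasso (G m) k (lambda m) (lambda_g m) (X m w) (y m w)
                 (betahat m w)) ->
  [/\ le_OP P (fun m w => l2norm (betahat m w - betastar m))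
        (fun m => sigma_eps * Num.sqrt ((s2 m)%:R * ln (n m)%:R / (N m)%:R)),
      le_OP P (fun m w => l1norm (betahat m w - betastar m))
        (fun m => sigma_eps * (s2 m)%:R * Num.sqrt (ln (n m)%:R / (N m)%:R)) &
      le_OP P (fun m w => (N m)%:R^-1 *
                 l2norm (X m w *m (betahat m w - betastar m)) ^+ 2)
        (fun m => sigma_eps ^+ 2 * ((s2 m)%:R * ln (n m)%:R / (N m)%:R))].
Proof.
have /andP[nu0 _] := hnu.
have D0 := column_const_gt0 hsigma_x; set D := column_const sigma_x in D0 *.
have kap0 := lower_rate_gt0 hsigma_x hc; set kap := lower_rate sigma_x c in kap0 *.
(* q = K0 s2 satisfies 36 s2 D <= q c / 4, as the cone case requires. *)
pose K0 := (Num.truncn (144 * D / c)).+1.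
have K0P : 144 * D <= K0%:R * c.
  by rewrite -ler_pdivrMr // ltW // truncnS_gt.
(* A is chosen so that the noise tail at level B is n^(- 8 B^2); C0 so that the
   number of signed sums and the number of columns are both absorbed. *)
pose A := 4 * Num.sqrt D; pose C0 := 8 * K0%:R / kap + 2.
have A0 : 0 < A by rewrite mulr_gt0 // sqrtr_gt0.
have A2 : A ^+ 2 / (2 * D) = 8.
  by rewrite exprMn (sqr_sqrtr (ltW D0)); field; rewrite gt_eqF.
have C00 : 0 < C0 by rewrite addr_gt0 // divr_gt0 // mulr_gt0.
exists A, C0; split => //; split => //.
move=> N n s1 s2 G disp Om P Sigma X eps y bs bh lam lamg Noo HN n1 s10 s20 nus bS rX eigS
  ie sube indeX yE lamE lamgE mbh Hl.
pose M0 := rate_const c A 2^-1 6.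
have ln2 : 0 < ln 2 :> R by rewrite ln_gt0 // ltr1n.
have core (delta : R) : 0 < delta -> exists M : R, \forall m \near \oo,
   (0 < N m)%N /\ recovery_whp (P m) (s2 m) sigma_eps (X m) (fun w => bh m w - bs m) delta M.
  move=> d0; pose e := delta / 3; have e0 : 0 < e by rewrite divr_gt0.
  have e3 : delta = e + e + e by rewrite /e; field.
  clearbody e.
  (* Threshold on the dimension: 2 / n <= e from n0 on. *)
  pose n0 := (Num.truncn (2 / e)).+1.
  have n0P : 2 / e <= n0%:R.
    by rewrite ltW // truncnS_gt.
  (* Noise level for n < n0: the failure probability is at most
     2 n0 exp (- 8 B log 2). *)
  pose B := 1 + 2 * n0%:R / (8 * ln 2 * e).
  have B1 : 1 <= B by rewrite lerDl ltW // !(mulr_gt0, invr_gt0).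
  have B0 : 0 < B by apply: lt_le_trans B1.
  pose q1 := (Num.truncn (4 * D * n0%:R / c)).+1.
  have q1P : D * n0%:R <= q1%:R * (c / 4).
    have /ltW := truncnS_gt (4 * D * n0%:R / c).
    by rewrite ler_pdivrMr //; rewrite /q1; lra.
  exists (M0 + rate_const c A B (Num.sqrt n0%:R)).
  pose Nmin : R := 1 / (kap / 2 * e) + 1 / (2^-1 * e) + (2 * n0%:R) ^+ q1.+1 / (kap * e).
  have NminP : \forall m \near \oo, Nmin <= (N m)%:R.
    have /cvgnyPge/(_ (Num.truncn Nmin).+1) := Noo.
    apply: filterS => m Hm; apply: le_trans (_ : (Num.truncn Nmin).+1%:R <= _); last by rewrite ler_nat.
    by rewrite ltW // truncnS_gt.
  have Npos : \forall m \near \oo, (0 < N m)%N by have /cvgnyPgt/(_ 0%N) := Noo.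
  near=> m.
  have N0 : (0 < N m)%N by near: m.
  split => //.
  have HNm : C0 * (s2 m)%:R * ln (n m)%:R <= (N m)%:R by near: m.
  have Nm : Nmin <= (N m)%:R by near: m.
  have L0 : 0 < ln (n m)%:R :> R by rewrite ln_gt0 // ltr1n.
  have s2r : 1 <= (s2 m)%:R :> R by rewrite ler1n.
  have kape : 0 < kap * e by rewrite mulr_gt0.
  have p1 : 0 <= 1 / (kap / 2 * e).
    by apply: divr_ge0 => //; apply: mulr_ge0; [apply: divr_ge0 => // |]; exact: ltW.
  have p2 : 0 <= 1 / (2^-1 * e).
    by apply: divr_ge0 => //; apply: mulr_ge0; [rewrite invr_ge0 | exact: ltW].
  have p3 : 0 <= (2 * n0%:R) ^+ q1.+1 / (kap * e).
    by apply: divr_ge0; [apply: exprn_ge0; apply: mulr_ge0 | exact: ltW].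
  have Nmin1 : 1 / (kap / 2 * e) <= (N m)%:R by move: Nm; rewrite /Nmin; lra.
  have Nmin2 : 1 / (2^-1 * e) <= (N m)%:R by move: Nm; rewrite /Nmin; lra.
  have Nmin3 : (2 * n0%:R) ^+ q1.+1 / (kap * e) <= (N m)%:R by move: Nm; rewrite /Nmin; lra.
  have HC0 : 8 * K0%:R / kap * (s2 m)%:R * ln (n m)%:R <= (N m)%:R.
    apply: le_trans HNm; rewrite ler_wpM2r ?(ltW L0) // ler_wpM2r // /C0 lerDl //.
  have HC2 : 2 * ln (n m)%:R <= (N m)%:R :> R.
    apply: le_trans HNm; rewrite ler_wpM2r ?(ltW L0) //.
    have : 0 <= 8 * K0%:R / kap * (s2 m)%:R by rewrite !mulr_ge0 // invr_ge0 ltW.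
    rewrite /C0; lra.
  have T2 : (n m)%:R * expR (- (N m)%:R) <= e :> R.
    apply: le_trans (_ : 1 * expR (- ((N m)%:R * 2^-1)) <= _); last exact: expRN_decay.
    rewrite mul1r (natr_expR_ln (ltnW (n1 m))) -expRD ler_expR; lra.
  (* Either case only has to check its own condition on q and that the first and
     the third failure probabilities are at most e; T2 covers the columns. *)
  have step B' kp (q : nat) : 0 < B' -> 0 <= kp -> (0 < q)%N ->
     (B' = 2^-1 /\ kp = 6 /\ D * (36 * (s2 m)%:R) <= q%:R * (c / 4) \/
       (n m)%:R <= kp ^+ 2 /\ D * (n m)%:R <= q%:R * (c / 4)) ->
     (2 * (n m)%:R) ^+ q.+1 * expR (- ((N m)%:R * kap)) <= e ->
     2 * (n m)%:R * expR (- (B' ^+ 2 * A ^+ 2 / (2 * D) * ln (n m)%:R)) <= e ->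
     rate_const c A B' kp <= M0 + rate_const c A B (Num.sqrt n0%:R) ->
     recovery_whp (P m) (s2 m) sigma_eps (X m) (fun w => bh m w - bs m) delta
       (M0 + rate_const c A B (Num.sqrt n0%:R)).
    move=> B'0 kp0 q0 Hcase T1 T3 MM.
    have gpp := @gpp_recovery R _ _ (P m) (N m) (n m) (s1 m) (s2 m) k q (G m) nu sigma_x sigma_eps c A B' kp (lam m)
      (Sigma m) (X m) (eps m) (bs m) (bh m) nu0 hsigma_x hsigma_eps hc A0 B'0 kp0 N0 (n1 m) (s10 m) (s20 m) q0
      (nus m) (bS m) (rX m) (fun x Hx => proj1 (andP (eigS m x Hx))) (ie m) (sube m) (indeX m) (lamE m) _ Hcase.
    apply: (recovery_whp_weaken (ltnW (n1 m)) (ltW hsigma_eps) _ MM (gpp _)).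
      by rewrite e3; apply: lerD => //; exact: lerD.
    by move=> w; rewrite -lamgE -yE; exact: Hl.
  have [nn0|nn0] := leqP n0 (n m).
    apply: (step 2^-1 6 (K0 * s2 m)%N) => //; last first.
    - by rewrite lerDl; apply: rate_const_ge0 => //; exact: ltW.
    - have -> : 2^-1 ^+ 2 * A ^+ 2 / (2 * D) = 2 by rewrite -mulrA A2; field.
      rewrite {1}(natr_expR_ln (ltnW (n1 m))) -mulrA -expRD.
      have -> : ln (n m)%:R - 2 * ln (n m)%:R = - ln (n m)%:R :> R by ring.
      rewrite expRN -natr_expR_ln ?(ltnW (n1 m)) // ler_pdivrMr ?ltr0n ?(ltnW (n1 m)) //.
      rewrite -ler_pdivrMl // mulrC; apply: le_trans n0P _; by rewrite ler_nat.
    - have := @sparse_union_cost_le R (n m) (s2 m) K0 (N m)%:R kap (n1 m) (s20 m) isT kap0 HC0.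
      move=> H; apply: le_trans H _.
      by rewrite -[leLHS]mul1r; apply: expRN_decay => //; rewrite divr_gt0.
    - left; split => //; split => //; rewrite natrM.
      have : 144 * D * (s2 m)%:R <= K0%:R * c * (s2 m)%:R by rewrite ler_wpM2r.
      lra.
    - by rewrite muln_gt0 /= s20.
  have nn0r : (n m)%:R <= n0%:R :> R by rewrite ler_nat ltnW.
  apply: (step B (Num.sqrt n0%:R) q1) => //; last first.
  - by rewrite lerDr; apply: rate_const_ge0 => //; rewrite invr_ge0.
  - apply: le_trans (_ : 2 * n0%:R * expR (- (B * (8 * ln 2))) <= _).
      apply: ler_pM; rewrite ?mulr_ge0 ?expR_ge0 // ?ler_wpM2l //.
      rewrite ler_expR lerN2.
      have -> : B ^+ 2 * A ^+ 2 / (2 * D) = B ^+ 2 * 8 by rewrite -mulrA A2.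
      have : ln 2 <= ln (n m)%:R :> R by rewrite ler_ln ?posrE ?ltr0n ?(ltnW (n1 m)) // ler_nat.
      have BB : B <= B ^+ 2 by rewrite expr2 ler_peMl // ltW.
      move=> lnn; rewrite mulrA; apply: ler_pM => //; rewrite ?mulr_ge0 ?(ltW B0) ?(ltW ln2) //.
      by rewrite ler_wpM2r.
    apply: expRN_decay => //; rewrite ?mulr_gt0 ?mulr_ge0 //.
    by rewrite /B lerDr.
  - apply: le_trans (_ : (2 * n0%:R) ^+ q1.+1 * expR (- ((N m)%:R * kap)) <= _).
      rewrite ler_wpM2r ?expR_ge0 // lerXn2r ?nnegrE ?mulr_ge0 // ler_wpM2l //.
    by apply: expRN_decay => //; rewrite exprn_ge0 // mulr_ge0.
  - right; rewrite sqr_sqrtr //; split => //.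
    by apply: le_trans q1P; rewrite ler_wpM2l // ltW.
have mX m := measurable_rows (let: And3 (And3 mX _ _) _ _ := rX m in mX).
have mh m a : measurable_fun setT (fun w => (bh m w - bs m) a 0).
  have /measurable_fun_tnthP/(_ a) mb := mbh m.
  rewrite (_ : (fun w => _) = (fun w => bh m w a 0 - bs m a 0)); last first.
    by apply/funext => w; rewrite !mxE.
  apply: measurable_funB => //.
  rewrite (_ : (fun w => _) = (@tnth _ _ ^~ a) \o (fun w => vtuple (bh m w))) //.
  by apply/funext => w /=; rewrite tnth_mktuple.
have rho0 m : (0 < N m)%N -> 0 < ln (n m)%:R / (N m)%:R :> R.
  by move=> N0; rewrite divr_gt0 ?ltr0n // ln_gt0 // ltr1n.
have s2p m : 0 < (s2 m)%:R :> R by rewrite ltr0n.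
split; apply: le_OP_of_events.
- by move=> m; exact: measurable_l2norm.
- by move=> m w; exact: l2norm_ge0.
- move=> delta /core[M H]; exists M; apply: filterS H => m [N0 [E [mE PE HE]]].
  split; first by rewrite mulr_gt0 // sqrtr_gt0 -mulrA mulr_gt0 // rho0.
  by exists E; split => // w /HE[].
- move=> m; apply: measurable_sum => a; exact: measurableT_comp.
- by move=> m w; exact: l1norm_ge0.
- move=> delta /core[M H]; exists M; apply: filterS H => m [N0 [E [mE PE HE]]].
  split; first by rewrite !mulr_gt0 // sqrtr_gt0 rho0.
  by exists E; split => // w /HE[].
- move=> m; apply: measurable_funM => //; under eq_fun do rewrite sqr_l2norm.
  apply: measurable_sqnorm => r; exact: measurable_mulmx.
- by move=> m w; rewrite mulr_ge0 ?sqr_ge0 // invr_ge0.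
- move=> delta /core[M H]; exists M; apply: filterS H => m [N0 [E [mE PE HE]]].
  split; first by rewrite mulr_gt0 ?exprn_gt0 // -mulrA mulr_gt0 // rho0.
  by exists E; split => // w /HE[].
Unshelve. all: by end_near.
Qed.
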